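(* In the setting below, let $(\varepsilon_N)\subset[0,\infty)$ with $\varepsilon_N\to0$, and let $(\bar u_N)$ be a sequence of random vectors with values in $\mathcal D(\psi)$ such that $\hat\Psi_N(\bar u_N)\le\varepsilon_N$ with probability one. Then (i) $\Psi(\bar u_N)\to0$ as $N\to\infty$ with probability one, and (ii) for almost all $\omega\in\Omega$, $(\bar u_N(\omega))$ has at least one weak accumulation point in $U$, and every such point is a zero of $\Psi$.
   Context: Let $U$ be a separable Hilbert space (identified with its dual, inner product $(\cdot,\cdot)_U$), $W$ a separable Banach space with dual $W^*$, and $B:U\to W$ a compact linear operator with adjoint $B^*:W^*\to U$. Let $\psi:U\to[0,\infty]$ be proper, closed and convex with bounded domain $\mathcal D(\psi)=\{u\in U:\psi(u)<\infty\}$. Let $U_0\subset U$ be open, convex and bounded with $\mathcal D(\psi)\subset U_0$. Let $\Xi$ be a complete separable metric space (with Borel $\sigma$-field), $\boldsymbol\xi$ a $\Xi$-valued random element, and $\boldsymbol\xi^1,\boldsymbol\xi^2,\ldots$ independent $\Xi$-valued random elements on a complete probability space $(\Omega,\mathcal F,P)$, each distributed as $\boldsymbol\xi$. Let $f:B(U_0)\times\Xi\to\mathbb R$ be such that $f(\cdot,\xi)$ is continuous on $B(\mathcal D(\psi))$ for each $\xi$, $f(w,\cdot)$ is measurable for each $w\in B(U_0)$, and $|f(Bu,\xi)|\le \zeta_f(\xi)$ for all $(u,\xi)\in U_0\times\Xi$ with $\zeta_f$ integrable. Assume further: for each $\xi$, $g_\xi:U_0\to\mathbb R$, $g_\xi(u)=f(Bu,\xi)$,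 is continuously differentiable; there is a Carathéodory map $\mathrm D_wf:B(\mathcal D(\psi))\times\Xi\to W^*$ with $\nabla g_\xi(u)=B^*\mathrm D_wf(Bu,\xi)$ for all $(u,\xi)\in\mathcal D(\psi)\times\Xi$; and there is an integrable $\zeta_{\mathrm Df}:\Xi\to[0,\infty)$ with $\|\nabla g_\xi(u)\|_U\le\zeta_{\mathrm Df}(\xi)$ on $U_0\times\Xi$ and $\|\mathrm D_wf(Bu,\xi)\|_{W^*}\le\zeta_{\mathrm Df}(\xi)$ on $\mathcal D(\psi)\times\Xi$. Define, for $w\in B(\mathcal D(\psi))$, $\mathrm DF(w)=\mathbb E[\mathrm D_wf(w,\boldsymbol\xi)]$ and $\mathrm D\hat F_N(w)=\frac1N\sum_{i=1}^N\mathrm D_wf(w,\boldsymbol\xi^i)$, and the gap functionals $\Psi,\hat\Psi_N:\mathcal D(\psi)\to[0,\infty]$, $\Psi(u)=\sup_{v\in\mathcal D(\psi)}[(B^*\mathrm DF(Bu),u-v)_U+\psi(u)-\psi(v)]$, $\hat\Psi_N(u)=\sup_{v\in\mathcal D(\psi)}[(B^*\mathrm D\hat F_N(Bu),u-v)_U+\psi(u)-\psi(v)]$. *)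

(* Defs.v *)
From HB Require Import structures.
From mathcomp Require Import all_boot all_order all_algebra.
From mathcomp Require Import all_classical all_reals all_analysis.
Set Implicit Arguments. Unset Strict Implicit. Unset Printing Implicit Defensive.
Import Order.TTheory GRing.Theory Num.Theory.
Import numFieldNormedType.Exports.
Local Open Scope classical_set_scope.
Local Open Scope ring_scope.

Section Defs.
Variable R : realType.

Definition is_inner_product (U : normedModType R) (ip : U -> U -> R) :=
  [/\ forall u v, ip u v = ip v u,
      forall (a : R) u v w, ip (a *: u + v) w = a * ip u w + ip v w
    & forall u, `|u| ^+ 2 = ip u u].

Definition separable_space (T : pseudoMetricType R) :=
  exists s : nat -> T, forall x (e : R), 0 < e -> exists n, ball x e (s n).

Definition is_linear (V W : lmodType R) (B : V -> W) :=
  forall (a : R) x y, B (a *: x + y) = a *: B x + B y.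

Definition bounded_subset (V : normedModType R) (A : set V) :=
  exists M : R, forall x, A x -> `|x| <= M.

Definition compact_operator (V W : normedModType R) (B : V -> W) :=
  is_linear B /\
  forall A : set V, bounded_subset A -> compact (closure (B @` A)).

Definition dual_elem (W : normedModType R) (phi : W -> R) :=
  (forall (a : R) x y, phi (a *: x + y) = a * phi x + phi y) /\ continuous phi.

Definition dnorm (W : normedModType R) (phi : W -> R) : R :=
  sup [set `|phi v| | v in [set v : W | `|v| <= 1]].

Definition dsub (W : normedModType R) (phi chi : W -> R) : W -> R :=
  fun v => phi v - chi v.

(* open sets of W^* for the norm topology (relative to W^* inside W -> R) *)
Definition dual_open (W : normedModType R) (S : set (W -> R)) :=
  forall phi, dual_elem phi -> S phi ->
  exists2 r : R, 0 < r &
    forall chi, dual_elem chi -> dnorm (dsub chi phi) < r -> S chi.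

Definition convex_subset (V : lmodType R) (A : set V) :=
  forall u v (l : R), A u -> A v -> 0 <= l <= 1 -> A (l *: u + (1 - l) *: v).

Definition convex_efun (V : lmodType R) (psi : V -> \bar R) :=
  forall (u v : V) (l : R), 0 <= l <= 1 ->
  (psi (l *: u + (1 - l) *: v)%R <= l%:E * psi u + (1 - l)%:E * psi v)%E.

Definition closed_efun (V : normedModType R) (psi : V -> \bar R) :=
  forall t : R, closed [set u | (psi u <= t%:E)%E].

Definition edom (V : Type) (psi : V -> \bar R) := [set u | (psi u < +oo)%E].

(* weak accumulation point of a sequence in the inner product space U:
   every weak neighbourhood of u contains x N for infinitely many N *)
Definition weak_cluster (U : normedModType R) (ip : U -> U -> R)
    (x : nat -> U) (u : U) :=
  forall (k : nat) (h : nat -> U) (e : R) (N0 : nat), 0 < e ->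
  exists N, (N0 <= N)%N /\ forall i, (i < k)%N -> `|ip (x N - u) (h i)| < e.

Definition complete_prob d (T : measurableType d) (P : probability T R) :=
  forall N : set T, P.-negligible N -> measurable N.

Definition indep_seq d d' (T : measurableType d) (X : measurableType d')
    (P : probability T R) (xs : nat -> T -> X) :=
  forall (s : seq nat) (A : nat -> set X), uniq s ->
  (forall i, measurable (A i)) ->
  P (\bigcap_(i in [set` s]) (xs i @^-1` A i)) =
  (\prod_(i <- s) P (xs i @^-1` A i))%E.

Definition same_law d d' (T : measurableType d) (X : measurableType d')
    (P : probability T R) (x y : T -> X) :=
  forall A : set X, measurable A -> P (x @^-1` A) = P (y @^-1` A).

(* DF(w) = E[D_w f(w, xi)] in W^*, given through its action on W *)
Definition DF d d' (T : measurableType d) (X : measurableType d')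
    (W : normedModType R) (P : probability T R) (xi : T -> X)
    (Dwf : W -> X -> (W -> R)) (w : W) : W -> R :=
  fun v => Rintegral P setT (fun om => Dwf w (xi om) v).

Definition DhatF (T : Type) (X : Type) (W : normedModType R)
    (N : nat) (xis : nat -> T -> X) (Dwf : W -> X -> (W -> R)) (om : T)
    (w : W) : W -> R :=
  fun v => N%:R^-1 * \sum_(i < N) Dwf w (xis i om) v.

Definition gap (U W : normedModType R) (ip : U -> U -> R) (B : U -> W)
    (Bstar : (W -> R) -> U) (psi : U -> \bar R) (G : W -> (W -> R)) (u : U)
    : \bar R :=
  ereal_sup [set ((ip (Bstar (G (B u))) (u - v))%:E + psi u - psi v)%E
            | v in edom psi].

End Defs.

Definition Borel (Xi : ptopologicalType) := g_sigma_algebraType (@open Xi).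

(* Main.v *)
Require Import Defs.
From HB Require Import structures.
From mathcomp Require Import all_boot all_order all_algebra.
From mathcomp Require Import all_classical all_reals all_analysis.
From mathcomp Require Import measurable_realfun ring lra zify.
Import Order.TTheory GRing.Theory Num.Theory.
Import numFieldNormedType.Exports.
Local Open Scope classical_set_scope.
Local Open Scope ring_scope.
Set Implicit Arguments. Unset Strict Implicit. Unset Printing Implicit Defensive.

(** The gap [Psi] differs from its empirical version on [dom psi] by at most
    [sup_v |(DhatF_N - DF)(B u) (B (u - v))|]. An approximate stationary point
    satisfies [psi (ubar N) <= t] eventually, for a deterministic [t]: compare with
    one fixed [v0] and use the strong law for [zetaD]. The sublevel set
    [psi <= t] is closed, convex and bounded, hence weakly compact, so that [B]
    maps it onto a compact set, and [B (u - v)] stays in a compact set as well.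
    Thus it suffices to have a uniform strong law for the real-valued
    Caratheodory function [(w, c), x |-> Dwf w x c] on a compact product, and no
    law of large numbers in the dual of [W] is needed. Uniform convergence gives
    (i) and the continuity of [DF]; (ii) follows from the weak lower
    semicontinuity of [psi] along an ultrafilter converging weakly to the given
    accumulation point. *)

(** * Weak convergence in Hilbert spaces and compact operators *)

(** The domain of [psi] need not be closed, so limits of points of [B (dom psi)] may leave the set
    on which [Dwf] is controlled; a sublevel set [psi <= t] does not have this defect. The level [t]
    must not depend on the outcome, because the null set of the uniform law depends on the compact
    set to which it is applied. The competitor [v] need not range over a compact set, but it enters
    the linear part of the gap only through [B (u - v)], while [psi v] is the same in both gaps and
    cancels. Ultrafilters take the place of subsequences: a single one makes all bounded families
    [ip (x t) h] converge at once. The price is that dominated convergence, a statement on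
    sequences, cannot be used along them; hence the continuity of [DF] is drawn from the uniform
    law. *)

Lemma ultra_fmap (S T : Type) (f : S -> T) (G : set_system S) :
  UltraFilter G -> UltraFilter (f @ G).
Proof.
move=> UG; constructor; first exact: fmap_proper_filter.
move=> H PH sub; apply/seteqP; split=> A HA; last exact: sub.
have [//|GC] := in_ultra_setVsetC (f @^-1` A) UG.
exfalso; apply: (@filter_not_empty _ H); rewrite -(setICr A).
by apply: filterI => //; exact: sub.
Qed.

(** Stands in for the extraction of a convergent subsequence; the same ultrafilter works for every
    map that eventually stays in a compact set. *)
Lemma compact_ultra_cvg {S : Type} {T : topologicalType} {G : set_system S}
    (f : S -> T) (A : set T) : UltraFilter G -> compact A ->
  (\forall t \near G, A (f t)) -> exists2 p, A p & f @ G --> p.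
Proof.
move=> UG; rewrite compact_ultra => cA GA.
by have [p [Ap fp]] := cA (f @ G) (ultra_fmap f UG) GA; exists p.
Qed.

Section Hilbert.
Variables (R : realType) (U : completeNormedModType R) (ip : U -> U -> R).
Hypothesis Hip : is_inner_product ip.

Lemma ipC u v : ip u v = ip v u. Proof. by case: Hip. Qed.

Lemma ipPl a u v w : ip (a *: u + v) w = a * ip u w + ip v w.
Proof. by case: Hip. Qed.

Lemma ip0l u : ip 0 u = 0.
Proof. by have := ipPl 1 0 0 u; rewrite scaler0 addr0; lra. Qed.

Lemma ipDl u v w : ip (u + v) w = ip u w + ip v w.
Proof. by rewrite -[u]scale1r ipPl mul1r scale1r. Qed.

Lemma ipZl a u w : ip (a *: u) w = a * ip u w.
Proof. by rewrite -[a *: u]addr0 ipPl ip0l addr0. Qed.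

Lemma ipNl u w : ip (- u) w = - ip u w.
Proof. by rewrite -scaleN1r ipZl mulN1r. Qed.

Lemma ipDr u v w : ip w (u + v) = ip w u + ip w v.
Proof. by rewrite !(ipC w) ipDl. Qed.

Lemma ipZr a u w : ip w (a *: u) = a * ip w u.
Proof. by rewrite !(ipC w) ipZl. Qed.

Lemma ipNr u w : ip w (- u) = - ip w u.
Proof. by rewrite !(ipC w) ipNl. Qed.

Definition ipE := (ipDl, ipDr, ipZl, ipZr, ipNl, ipNr).

Lemma normE u : `|u| ^+ 2 = ip u u. Proof. by case: Hip. Qed.

Lemma ip_cauchy_schwarz u v : `|ip u v| <= `|u| * `|v|.
Proof.
have [->|v0] := eqVneq v 0; first by rewrite ipC ip0l !normr0 mulr0.
have q0 : 0 < ip v v by rewrite -normE exprn_gt0// normr_gt0.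
rewrite -(@ler_pXn2r _ 2) ?nnegrE ?mulr_ge0//.
have : 0 <= ip v v * `|u - (ip u v / ip v v) *: v| ^+ 2.
  by rewrite mulr_ge0 ?sqr_ge0// ltW.
rewrite normE !ipE (ipC v u).
set a := ip u v; set b := ip v v.
have -> : b * (ip u u - a / b * a + (- (a / b * a) - - (a / b * (a / b * b)))) =
  b * ip u u - a ^+ 2.
  by field; rewrite gt_eqF.
rewrite subr_ge0 real_normK ?num_real// exprMn !normE -/a -/b; lra.
Qed.

(** * Minimisation of quadratic functionals: projections and Riesz representation *)

Section quadratic.
Variables (L : U -> R) (M : R).
Hypothesis LP : forall a x y, L (a *: x + y) = a * L x + L y.
Hypothesis LM : forall x, `|L x| <= M * `|x|.

Let J c := `|c| ^+ 2 - 2 * L c.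

(** Serves twice: for [L = ip u] the functional is [|c - u|^2 - |u|^2], so the minimiser is the
    projection of [u] on [C]; for general bounded [L] on the whole space it is the Riesz vector. By
    strong convexity minimising sequences are Cauchy. *)
Lemma quadratic_min (C : set U) : closed C -> convex_subset C -> C !=set0 ->
  exists2 p, C p & forall c, C c ->
    `|p| ^+ 2 - 2 * L p <= `|c| ^+ 2 - 2 * L c.
Proof.
move=> Ccl Ccvx [c0 Cc0].
have LD x y : L (x + y) = L x + L y by rewrite -[x]scale1r LP mul1r scale1r.
have L0 : L 0 = 0 by have := LD 0 0; rewrite addr0; lra.
have LZ a x : L (a *: x) = a * L x by rewrite -[a *: x]addr0 LP L0 addr0.
have LN x : L (- x) = - L x by rewrite -scaleN1r LZ mulN1r.
have hiE : has_inf (J @` C).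
  split; first by exists (J c0), c0.
  (* As [|L c| <= M |c|], the functional is at least [(M - |c|)^2 - M^2]. *)
  exists (- M ^+ 2) => _ [c _ <-]; rewrite /J.
  have := LM c; have := ler_norm (L c); have := sqr_ge0 (M - `|c|); lra.
set d := inf (J @` C).
have dJ c : C c -> d <= J c by move=> Cc; apply: ge_inf; [case: hiE|exists c].
have /choice[x xP] : forall n, exists c, C c /\ J c < d + n.+1%:R^-1.
  by move=> n; have [|_ [c Cc <-] Jc] := @inf_adherent _ (J @` C) n.+1%:R^-1 _ hiE;
    [rewrite invr_gt0|exists c].
have xcvg : cvg (x @ \oo).
  apply: cauchy_cvg; apply: cauchy_exP => e e0.
  have [n _ nP] : \forall n \near \oo, n.+1%:R^-1 < e ^+ 2 / 4 :> R.
    by apply: near_infty_natSinv_lt (PosNum _); rewrite divr_gt0// exprn_gt0.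
  have {}nP := nP n (leqnn n).
  exists (x n); exists n => // m /= nm; rewrite -ball_normE /ball_/=.
  rewrite -(@ltr_pXn2r _ 2) ?nnegrE ?normr_ge0 ?ltW//.
  have [Cn Jn] := xP n; have [Cm Jm] := xP m.
  (* By the parallelogram law the value at the midpoint is the mean of the two values minus
     [|x n - x m|^2 / 4]. It is at least [d], whence [|x n - x m|^2 < 4 / (n + 1) < e^2]. *)
  have := dJ _ (Ccvx _ _ (2^-1) Cn Cm _).
  have -> : 0 <= (2^-1 : R) <= 1 by lra.
  move=> /(_ isT).
  have nm' : m.+1%:R^-1 <= n.+1%:R^-1 :> R.
    by rewrite lef_pV2 ?posrE// ler_nat.
  move: Jn Jm; rewrite /J !normE LP LZ !ipE (ipC (x m) (x n)).
  move: nP nm'; set a := n.+1%:R^-1; set b := m.+1%:R^-1; lra.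
have Jcvg : J (x n) @[n --> \oo] --> J (lim (x @ \oo)).
  apply: cvgB.
    by under eq_fun do rewrite expr2; rewrite expr2; apply: cvgM; exact: cvg_norm.
  apply: cvgMr; apply/cvgrPdist_lt => e e0.
  have M0 : 0 < `|M| + 1 by rewrite ltr_wpDl.
  near=> n; rewrite -LN -LD; apply: (le_lt_trans (LM _)).
  have H : `|lim (x @ \oo) - x n| < e / (`|M| + 1).
    by near: n; apply: cvgr_dist_lt => //; rewrite divr_gt0.
  rewrite ltr_pdivlMr// mulrC in H; apply: le_lt_trans H.
  by rewrite ler_wpM2r//; have := ler_norm M; lra.
exists (lim (x @ \oo)).
  by apply: (closed_cvg C Ccl _ _ xcvg); apply: nearW => n; have [] := xP n.
move=> c /dJ; apply: le_trans.
have dcvg : d + n.+1%:R^-1 @[n --> \oo] --> d.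
  by rewrite -[X in _ --> X]addr0; apply: cvgD; [exact: cvg_cst|exact: cvg_harmonic].
apply: ler_cvg_to Jcvg dcvg _.
by apply: nearW => n; apply: ltW; have [] := xP n.
Unshelve. all: by end_near. Qed.

(** This is the first-order condition at the minimiser [p] over the whole space: the derivative in
    the direction [h] is [2 (ip p h - L h)]. *)
Lemma riesz_representation : exists u, forall h, ip u h = L h.
Proof.
have [||p _ pP] := quadratic_min closedT; [by []|by exists 0|].
exists p => h.
set a := ip p h - L h; set q := ip h h.
have q0 : 0 <= q by rewrite /q -normE sqr_ge0.
have := pP ((- a / (q + 1)) *: h + p) I.
rewrite LP !normE !ipE (ipC h p) -/q.
(* Moving by [s] along [h] changes the functional by [s (2 a + s q)], which for this [s] is
   [- s^2 (q + 2)]; the [+ 1] keeps the denominator positive when [h = 0]. *)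
set s := - a / (q + 1).
have sE : s * (q + 1) = - a by rewrite /s divfK// gt_eqF//; lra.
have -> : L h = ip p h - a by rewrite /a; lra.
move=> H.
have {}H : 0 <= s * (2 * a + s * q) by lra.
have aE : a = - (s * (q + 1)) by lra.
have {}H : s ^+ 2 * (q + 2) <= 0 by move: H; rewrite aE; lra.
have s0 : s = 0.
  apply/eqP; rewrite -sqrf_eq0 eq_le sqr_ge0 andbT.
  by have : 0 < q + 2 by [lra]; move=> q2; rewrite pmulr_lle0 in H.
by rewrite aE s0; lra.
Qed.

End quadratic.

Definition weak_cvg {T : Type} (G : set_system T) (x : T -> U) (u : U) :=
  forall h, ip (x t) h @[t --> G] --> ip u h.

(** Weak compactness of balls: for each [h] the numbers [ip (x t) h] lie in a segment and converge
    along [G]; the limits form a bounded linear functional of [h], which Riesz represents. *)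
Lemma bounded_weak_cvg {T : Type} {G : set_system T} (x : T -> U) (M : R) :
  UltraFilter G -> (\forall t \near G, `|x t| <= M) -> exists u, weak_cvg G x u.
Proof.
move=> UG GM.
have M0 : 0 <= M.
  by have /filter_ex[t] := GM; apply: le_trans.
have lb h : \forall t \near G, `[- (M * `|h|), M * `|h|]%classic (ip (x t) h).
  apply: filterS GM => t tM /=; rewrite in_itv/= -ler_norml.
  by apply: (le_trans (ip_cauchy_schwarz _ _)); rewrite ler_wpM2r.
have /choice[L LP] h :
    exists l, `|l| <= M * `|h| /\ ip (x t) h @[t --> G] --> l.
  have [l] := compact_ultra_cvg UG (@segment_compact _ _ _) (lb h).
  by rewrite /= in_itv/= -ler_norml => ? ?; exists l.
have [||u uL] := @riesz_representation L M.
- move=> a h k; apply: (@cvg_unique _ _ (ip (x t) (a *: h + k) @[t --> G])) => //.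
    by case: (LP (a *: h + k)).
  have -> : (fun t => ip (x t) (a *: h + k)) =
    (fun t => a * ip (x t) h + ip (x t) k).
    by apply/funext => t; rewrite ipDr ipZr.
  by apply: cvgD; [apply: cvgMr|]; apply (LP _).2.
- by move=> h; have [] := LP h.
by exists u => h; rewrite uL; have [] := LP h.
Qed.

(* Test against [p - u], where [p] is the projection of [u] on [C]. *)
Lemma closed_convex_weak_closed {T : Type} {G : set_system T}
    {PG : ProperFilter G} (C : set U) (x : T -> U) (u : U) :
  closed C -> convex_subset C -> (\forall t \near G, C (x t)) ->
  weak_cvg G x u -> C u.
Proof.
move=> Ccl Ccvx GC xu.
have C0 : C !=set0 by have /filter_ex[t] := GC; exists (x t).
have [||p Cp pP] := @quadratic_min (ip u) `|u| _ _ C Ccl Ccvx C0.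
- by move=> a y z; rewrite ipDr ipZr.
- by move=> y; exact: ip_cauchy_schwarz.
have var c : C c -> 0 <= ip c (p - u) - ip p (p - u).
  move=> Cc; rewrite leNgt; apply/negP => a0.
  set a := _ - _ in a0.
  pose q := ip (c - p) (c - p).
  have q0 : 0 <= q by rewrite /q -normE sqr_ge0.
  have qa : 0 < q - a by lra.
  (* Moving by [s] from [p] towards [c] changes the functional by [s (2 a + s q)]; this [s] lies in
     [[0, 1]] and turns the bracket into [a (1 + s) < 0], against minimality. *)
  pose s := - a / (q - a).
  have s01 : 0 <= s <= 1.
    by rewrite /s divr_ge0 ?ler_pdivrMr//; lra.
  have sE : s * (q - a) = - a by rewrite /s divfK// gt_eqF.
  have s0 : 0 < s by rewrite divr_gt0//; lra.
  have := pP _ (Ccvx _ _ s Cc Cp s01); rewrite -subr_ge0.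
  have -> : `|s *: c + (1 - s) *: p| ^+ 2 - 2 * ip u (s *: c + (1 - s) *: p) -
      (`|p| ^+ 2 - 2 * ip u p) = s * (2 * a + s * q).
    by rewrite /a /q !normE !ipE (ipC c p) (ipC c u) (ipC p u); ring.
  rewrite pmulr_rge0//; move: s01 => /andP[_ s1].
  have : s * a >= a by nra.
  nra.
have lim0 : 0 <= ip u (p - u) - ip p (p - u).
  have cv : ip (x t) (p - u) - ip p (p - u) @[t --> G] -->
      ip u (p - u) - ip p (p - u) by apply: cvgB; [exact: xu|exact: cvg_cst].
  have := @closed_cvg _ _ _ _ _ [set r : R | 0 <= r] (@closed_ge _ _) _ _ cv.
  apply.
  by apply: filterS GC => t /var.
have : ip (p - u) (p - u) <= 0 by rewrite ipDl ipNl; lra.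
rewrite -normE => H.
have : p - u = 0.
  by apply/eqP; rewrite -normr_eq0 -sqrf_eq0 eq_le H sqr_ge0.
by move/eqP; rewrite subr_eq0 => /eqP <-.
Qed.

Lemma norm_le_bounded_subset (V : normedModType R) (M : R) :
  bounded_subset [set v : V | `|v| <= M].
Proof. by exists M. Qed.

(** * Compact operators turn weak convergence into norm convergence *)

Section compact_operator.
Variables (W : normedModType R) (B : U -> W).
Hypothesis HB : compact_operator B.

Lemma compact_operatorP a x y : B (a *: x + y) = a *: B x + B y.
Proof. by case: HB. Qed.

Lemma compact_operator0 : B 0 = 0.
Proof.
have := compact_operatorP 1 0 0; rewrite scaler0 scale1r addr0 => /eqP.
by rewrite -subr_eq subrr eq_sym => /eqP.
Qed.

Lemma compact_operatorD x y : B (x + y) = B x + B y.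
Proof. by rewrite -[x]scale1r compact_operatorP !scale1r. Qed.

Lemma compact_operatorZ a x : B (a *: x) = a *: B x.
Proof. by rewrite -[a *: x]addr0 compact_operatorP compact_operator0 addr0. Qed.

Lemma compact_operatorB x y : B (x - y) = B x - B y.
Proof. by rewrite compact_operatorD -scaleN1r compact_operatorZ scaleN1r. Qed.

Lemma compact_operator_bounded : exists2 K, 0 <= K & forall x, `|B x| <= K * `|x|.
Proof.
have [_ /(_ [set x | `|x| <= 1])] := HB.
move=> /(_ (@norm_le_bounded_subset U 1)) /compact_bounded [K [_ KP]].
have KP' := KP (`|K| + 1) _.
have K1 : K < `|K| + 1 by rewrite (le_lt_trans (ler_norm K))// ltrDl.
exists (`|K| + 1); first by rewrite addr_ge0.
move=> x; have [->|x0] := eqVneq x 0; first by rewrite compact_operator0 !normr0 mulr0.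
have xp : 0 < `|x| by rewrite normr_gt0.
have : `|B (`|x|^-1 *: x)| <= `|K| + 1.
  apply: KP' => //; apply: subset_closure; exists (`|x|^-1 *: x) => //=.
  by rewrite normrZ normfV normr_id mulVf// gt_eqF.
by rewrite compact_operatorZ normrZ normfV normr_id -ler_pdivlMl ?invr_gt0// invrK mulrC.
Qed.

Lemma compact_operator_continuous : continuous B.
Proof.
have [K K0 BK] := compact_operator_bounded.
move=> x; apply/cvgrPdist_lt => e e0.
have K1 : 0 < K + 1 by rewrite ltr_wpDl.
near=> y; rewrite -compact_operatorB; apply: (le_lt_trans (BK _)).
have : `|x - y| < e / (K + 1).
  by near: y; apply: cvgr_dist_lt => //; rewrite divr_gt0.
rewrite ltr_pdivlMr// mulrC; apply: le_lt_trans.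
by rewrite ler_wpM2r// lerDl.
Unshelve. all: by end_near. Qed.

(** Compactness gives some limit [w] of [B (x t)]. It is identified without functionals on [W]: each
    set of [v] with [|B v - w| <= e] is closed, convex and eventually contains [x t], hence contains
    the weak limit [u]. *)
Lemma compact_operator_weak_strong {T : Type} {G : set_system T} (x : T -> U) u M :
  UltraFilter G -> (\forall t \near G, `|x t| <= M) -> weak_cvg G x u ->
  B (x t) @[t --> G] --> B u.
Proof.
move=> UG GM xu; have [_ cB] := HB.
have [w _ Bw] := compact_ultra_cvg UG
  (cB [set v | `|v| <= M] (@norm_le_bounded_subset U M))
  (filterS (fun t h => subset_closure (ex_intro2 _ _ (x t) h erefl)) GM).
suff -> : B u = w by [].
have uC e : 0 < e -> `|B u - w| <= e.
  move=> e0.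
  apply: (@closed_convex_weak_closed _ G _ [set v | `|B v - w| <= e] x) => //.
  - apply: (@preimage_closed _ _ (fun v => `|B v - w|) [set r | r <= e]).
      move=> v _; apply: (@continuous_comp _ _ _ (fun v => B v - w) Num.norm).
        by apply: cvgB; [exact: compact_operator_continuous|exact: cvg_cst].
      exact: norm_continuous.
    exact: closed_le.
  - move=> v1 v2 l /= h1 h2 /andP[l0 l1].
    have -> : B (l *: v1 + (1 - l) *: v2) - w = l *: (B v1 - w) + (1 - l) *: (B v2 - w).
      rewrite compact_operatorD !compact_operatorZ !scalerBr addrACA -opprD.
      by rewrite -scalerDl addrCA subrr addr0 scale1r.
    rewrite (le_trans (ler_normD _ _))// !normrZ !ger0_norm ?subr_ge0//.
    have := ler_wpM2l l0 h1; have : 0 <= 1 - l by lra.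
    by move=> l2; have := ler_wpM2l l2 h2; lra.
  - by near=> t; rewrite /= distrC ltW//; near: t; apply: cvgr_dist_lt.
apply/eqP; rewrite -subr_eq0 -normr_le0; apply/ler_addgt0Pl => e /uC; lra.
Unshelve. all: by end_near. Qed.

(** An ultrafilter on the image is lifted to [S] through a choice of preimages; their weak limit
    stays in [S], and [B] makes the convergence strong. *)
Lemma compact_operator_image (S : set U) : closed S -> convex_subset S ->
  bounded_subset S -> compact (B @` S).
Proof.
move=> Scl Scvx [M SM]; rewrite compact_ultra => F UF FBS /=.
have /choice[s sP] w : exists u, (B @` S) w -> S u /\ B u = w.
  by have [[u Su <-]|] := pselect ((B @` S) w); [exists u|exists 0].
have FS : \forall w \near F, S (s w) /\ B (s w) = w by apply: filterS FBS => w /sP.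
have FM : \forall w \near F, `|s w| <= M by apply: filterS FS => w [/SM].
have [u su] := bounded_weak_cvg UF FM.
exists (B u); split.
  exists u => //; apply: closed_convex_weak_closed su => //.
  by apply: filterS FS => w [].
have := compact_operator_weak_strong UF FM su.
apply: cvg_trans => A; rewrite /fmap /= => FA; near=> w.
have [_ <-] : S (s w) /\ B (s w) = w by near: w.
by near: w.
Unshelve. all: by end_near. Qed.

End compact_operator.

End Hilbert.

(** * The strong law of large numbers *)

Lemma nneseries_le_bound {R : realType} (u : (\bar R)^nat) (C : \bar R) :
  (forall n, (0 <= u n)%E) -> (forall m, (\sum_(0 <= n < m) u n <= C)%E) ->
  (\sum_(n <oo) u n <= C)%E.
Proof.
move=> u0 uC; apply: lime_le; first exact: is_cvg_nneseries.
by apply: nearW => m; exact: uC.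
Qed.

Lemma sume_const_ord {R : realType} (q : \bar R) n :
  (\sum_(i < n) q = n%:R%:E * q)%E.
Proof. by rewrite sumr_const card_ord mule_natl. Qed.

(** The series of the [g n] has a finite integral, so it converges almost everywhere and its terms
    vanish in the limit. Applied to squared deviations and to counts, this does the work of
    Chebyshev and Borel-Cantelli. *)
Lemma ae_cvg0_of_summable {d} {T : measurableType d} {R : realType}
    (mu : {measure set T -> \bar R}) (g : nat -> T -> R) :
  (forall n, measurable_fun setT (g n)) -> (forall n t, 0 <= g n t) ->
  (\sum_(n <oo) \int[mu]_t (g n t)%:E < +oo)%E ->
  {ae mu, forall t, g n t @[n --> \oo] --> 0}.
Proof.
move=> mg g0 sg.
pose G t := (\sum_(n <oo) (g n t)%:E)%E.
have G0 t : (0 <= G t)%E by apply: nneseries_ge0 => n _ _; rewrite lee_fin.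
have mG : measurable_fun setT G.
  apply: ge0_emeasurable_sum => [n t _ _|n _]; first by rewrite lee_fin.
  exact/measurable_EFinP.
have iG : mu.-integrable setT G.
  apply/integrableP; split => //.
  under eq_integral do rewrite gee0_abs//.
  rewrite integral_nneseries// => [n|n t _]; last by rewrite lee_fin.
  exact/measurable_EFinP.
have := integrable_ae measurableT iG.
apply: filterS => t /(_ I) Gfin.
have : (G t < +oo)%E by rewrite ltey_eq Gfin.
move/nneseries_tail_cvg => /(_ (fun k _ => g0 k t)) tail.
have : (g n t)%:E @[n --> \oo] --> 0%E.
  apply: (squeeze_cvge _ (cvg_cst _) tail).
  apply: nearW => n; rewrite lee_fin g0/=.
  rewrite (@nneseries_split _ _ n 1) => [|k _]; last by rewrite lee_fin.
  rewrite addn1 big_nat1 leeDl// nneseries_ge0// => k _ _; by rewrite lee_fin.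
by move/fine_cvg.
Qed.

Lemma dyadic_square_sum {R : realType} (z : R) m : 0 <= z ->
  \sum_(0 <= n < m) (if z <= 2 ^+ n then z ^+ 2 / 2 ^+ n else 0) <= 2 * z.
Proof.
move=> z0.
(* Once [z <= 2 ^+ n] the terms are geometric with ratio [1 / 2], so those from [m] on add up to
   [2 z^2 / 2^m]. Subtracting this tail makes the bound inductive; the maximum covers the range
   where all terms are still zero. *)
suff : \sum_(0 <= n < m) (if z <= 2 ^+ n then z ^+ 2 / 2 ^+ n else 0) <=
    Num.max 0 (2 * z - 2 * (z ^+ 2 / 2 ^+ m)).
  move/le_trans; apply; rewrite ge_max; apply/andP; split; first lra.
  by rewrite lerBlDr lerDl mulr_ge0// divr_ge0// ?exprn_ge0// sqr_ge0.
elim: m => [|m IH]; first by rewrite big_nil le_max lexx.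
rewrite big_nat_recr//=; have p0 : 0 < 2 ^+ m :> R by rewrite exprn_gt0.
have SE : z ^+ 2 / 2 ^+ m.+1 = (z ^+ 2 / 2 ^+ m) / 2.
  by rewrite [2 ^+ m.+1]exprS invfM; ring.
have q0 : 0 <= z ^+ 2 / 2 ^+ m by rewrite divr_ge0 ?sqr_ge0 ?ltW.
rewrite SE; case: ifPn => zm.
  have zq : z ^+ 2 / 2 ^+ m <= z by rewrite ler_pdivrMr// expr2 ler_wpM2l.
  rewrite le_max; apply/orP; right.
  move: IH; rewrite le_max => /orP[]; lra.
rewrite addr0; apply: (le_trans IH); rewrite ge_max !le_max lexx/=.
by apply/orP; right; lra.
Qed.

(** The nonzero terms are the powers of two below [z], a geometric sum dominated by twice its last
    term; the companion bound [2 ^+ m] carries the induction. *)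
Lemma dyadic_tail_sum {R : realType} (z : R) m : 0 <= z ->
  \sum_(0 <= n < m) (if 2 ^+ n < z then 2 ^+ n else 0) <= 2 * z.
Proof.
move=> z0.
pose s m := \sum_(0 <= n < m) (if 2 ^+ n < z then 2 ^+ n else 0 : R).
suff H : (s m <= 2 ^+ m) /\ (s m <= 2 * z) by case: H.
rewrite /s {s}.
elim: m => [|m [IH1 IH2]]; first by rewrite big_nil expr0 ler01 mulr_ge0.
rewrite big_nat_recr//= exprS; have p0 : 0 < 2 ^+ m :> R by rewrite exprn_gt0.
by case: ifPn => zm; split; lra.
Qed.

Lemma ler_sum_ord {R : realType} (f : nat -> R) m n :
  (forall i, 0 <= f i) -> (m <= n)%N ->
  \sum_(i < m) f i <= \sum_(i < n) f i.
Proof.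
move=> f0 mn; rewrite -!(big_mkord xpredT) (big_cat_nat (m := 0) (n := m) (p := n))//=.
by rewrite lerDl sumr_ge0.
Qed.

Lemma floor_sqrt (n : nat) : exists m, (m ^ 2 <= n < m.+1 ^ 2)%N.
Proof.
elim: n => [|n [m /andP[lo hi]]]; first by exists 0%N.
have [h|h] := ltnP n.+1 (m.+1 ^ 2); first by exists m; rewrite h ltnW.
by exists m.+1; rewrite h/= (leq_ltn_trans hi)// ltn_exp2r.
Qed.

Lemma ler_sum_invr_sqr {R : realType} m :
  \sum_(0 <= n < m) (n.+1%:R ^+ 2)^-1 <= 2 :> R.
Proof.
suff H : \sum_(0 <= n < m.+1) (n.+1%:R ^+ 2)^-1 <= 2 - m.+1%:R^-1 :> R.
  move: H; rewrite big_nat_recr//=.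
  have : 0 <= (m.+1%:R ^+ 2)^-1 :> R by rewrite invr_ge0 sqr_ge0.
  have : 0 <= m.+1%:R^-1 :> R by rewrite invr_ge0.
  move: (m.+1%:R^-1) (m.+1%:R ^- 2) (\sum_(0 <= n < m) n.+1%:R ^- 2) => a b s; lra.
elim: m => [|m IH]; first by rewrite big_nat1 expr1n invr1; lra.
rewrite big_nat_recr//= (le_trans (lerD IH (lexx _)))//.
have m0 : 0 < m.+1%:R :> R by rewrite ltr0n.
rewrite -subr_ge0 -[m.+2%:R]natr1; set z := m.+1%:R in m0 *.
have -> : 2 - (z + 1)^-1 - (2 - z^-1 + ((z + 1) ^+ 2)^-1) = (z * (z + 1) ^+ 2)^-1.
  by field; apply/andP; split; rewrite gt_eqF//; lra.
by rewrite invr_ge0 mulr_ge0 ?sqr_ge0 ?ltW.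
Qed.

Lemma norm_le_of_sqr {R : realType} (y r : R) :
  0 <= r -> y ^+ 2 <= r ^+ 2 -> `|y| <= r.
Proof.
by move=> r0; rewrite -(@ler_pXn2r _ 2 _ `|y|) ?nnegrE// real_normK ?num_real.
Qed.

Section strong_law.
Context {R : realType} {d d' : measure_display}.
Variables (T : measurableType d) (X : measurableType d') (P : probability T R).
Variables (x : T -> X) (xs : nat -> T -> X).
Hypothesis mx : measurable_fun setT x.
Hypothesis mxs : forall i, measurable_fun setT (xs i).
Hypothesis indep : indep_seq P xs.
Hypothesis law : forall i, same_law P (xs i) x.

Lemma probability_measure1 : (P : {measure set T -> \bar R}) setT = 1%E.
Proof. exact: probability_setT. Qed.

Lemma ge0_integral_same_law (f : X -> \bar R) i :
  measurable_fun setT f -> (forall y, (0 <= f y)%E) ->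
  (\int[P]_t f (xs i t) = \int[P]_t f (x t))%E.
Proof.
move=> mf f0.
transitivity (\int[pushforward P (xs i)]_y f y)%E.
  by rewrite ge0_integral_pushforward.
transitivity (\int[pushforward P x]_y f y)%E; last first.
  by rewrite ge0_integral_pushforward.
pose x' : {mfun T >-> X} := HB.pack x (isMeasurableFun.Build _ _ _ _ x mx).
pose xi' : {mfun T >-> X} :=
  HB.pack (xs i) (isMeasurableFun.Build _ _ _ _ (xs i) (mxs i)).
apply: (@eq_measure_integral _ _ _ _ (pushforward P x') (pushforward P xi')) => A mA _.
exact: law.
Qed.

(** The joint law of [(xs i, xs j)] agrees with the product of the marginals on rectangles, hence
    everywhere; Tonelli then factors the integral. *)
Lemma ge0_integral_indepM (f g : X -> \bar R) i j : i != j ->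
  measurable_fun setT f -> (forall y, (0 <= f y)%E) ->
  measurable_fun setT g -> (forall y, (0 <= g y)%E) ->
  (\int[P]_t (f (xs i t) * g (xs j t)) =
   (\int[P]_t f (x t)) * (\int[P]_t g (x t)))%E.
Proof.
move=> ij mf f0 mg g0.
pose xi' : {mfun T >-> X} :=
  HB.pack (xs i) (isMeasurableFun.Build _ _ _ _ (xs i) (mxs i)).
pose xj' : {mfun T >-> X} :=
  HB.pack (xs j) (isMeasurableFun.Build _ _ _ _ (xs j) (mxs j)).
pose pr t := (xs i t, xs j t).
have mpr : measurable_fun setT pr by exact: measurable_fun_pair.
pose pr' : {mfun T >-> (X * X)%type} := HB.pack pr (isMeasurableFun.Build _ _ _ _ pr mpr).
have mfg : measurable_fun setT (fun z : X * X => (f z.1 * g z.2)%E).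
  by apply: emeasurable_funM; [apply: (measurableT_comp mf)|apply: (measurableT_comp mg)].
transitivity (\int[pushforward P pr']_z (f z.1 * g z.2))%E.
  by rewrite ge0_integral_pushforward// => z _; exact: mule_ge0.
transitivity (\int[distribution P xi' \x distribution P xj']_z (f z.1 * g z.2))%E.
  apply/esym/eq_measure_integral => A mA _.
  apply: product_measure_unique => // B C mB mC.
  have := @indep [:: i; j] (fun k => if k == i then B else C).
  rewrite !big_cons big_nil eqxx eq_sym (negbTE ij) mule1/=.
  rewrite inE ij => /(_ isT) <-; last by move=> k; case: ifP.
  congr (P _); apply/seteqP; split => [t [/= tB tC] k /=|t H /=].
    by rewrite !inE => /orP[/eqP ->|/eqP ->]; rewrite ?eqxx// eq_sym (negbTE ij).
  split.
    by have := H i; rewrite /= inE eqxx; apply.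
  by have := H j; rewrite /= !inE eqxx orbT eq_sym (negbTE ij); apply.
rewrite fubini_tonelli1//; last by move=> z; exact: mule_ge0.
rewrite /fubini_F/=.
under eq_integral do rewrite ge0_integralZl//.
rewrite ge0_integralZr//; last exact: integral_ge0.
congr (_ * _)%E.
  transitivity (\int[pushforward P xi']_y f y)%E => //.
  by rewrite ge0_integral_pushforward//; exact: ge0_integral_same_law.
transitivity (\int[pushforward P xj']_y g y)%E => //.
by rewrite ge0_integral_pushforward//; exact: ge0_integral_same_law.
Qed.

Local Notation E f := (Rintegral P setT (fun t => f (x t))).

(* Only pairwise independence enters, through the vanishing covariances. *)
Lemma integral_variance_le (f : X -> R) n :
  measurable_fun setT f -> (forall y, 0 <= f y) ->
  P.-integrable setT (fun t => (f (x t))%:E) ->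
  (\int[P]_t ((\sum_(i < n) f (xs i t) - n%:R * E f) ^+ 2)%:E <=
   n%:R%:E * \int[P]_t ((f (x t)) ^+ 2)%:E)%E.
Proof.
move=> mf f0 fint; set a := E f; pose q := (\int[P]_t ((f (x t)) ^+ 2)%:E)%E; rewrite -/q.
have a0 : 0 <= a by exact: Rintegral_ge0.
have aE : (\int[P]_t (f (x t))%:E = a%:E)%E.
  by rewrite /a /Rintegral fineK//; exact: integrable_fin_num.
have q0 : (0 <= q)%E by apply: integral_ge0 => t _; rewrite lee_fin sqr_ge0.
have mfe : measurable_fun setT (fun y => (f y)%:E) by exact/measurable_EFinP.
have mfx i : measurable_fun setT (fun t => f (xs i t)) by exact: measurableT_comp.
pose S t := \sum_(i < n) f (xs i t).
have mS : measurable_fun setT S by exact: measurable_sum.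
have S0 t : 0 <= S t by exact: sumr_ge0.
have ES : (\int[P]_t (S t)%:E = (n%:R * a)%:E)%E.
  under eq_integral do rewrite -sumEFin.
  rewrite ge0_integral_sum//; last 2 first.
  - by move=> i; exact/measurable_EFinP.
  - by move=> i t _; rewrite lee_fin.
  rewrite (eq_bigr (fun=> a%:E)) => [|i _].
    by rewrite sumEFin sumr_const card_ord mulr_natl.
  by rewrite (ge0_integral_same_law _ mfe).
have ES2 : (\int[P]_t ((S t) ^+ 2)%:E <= n%:R%:E * q + ((n%:R * a) ^+ 2)%:E)%E.
  have SE t : ((S t) ^+ 2)%:E =
      (\sum_(i < n) \sum_(j < n) (f (xs i t))%:E * (f (xs j t))%:E)%E.
    rewrite expr2 /S big_distrlr/= -sumEFin; apply: eq_bigr => i _.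
    by rewrite -sumEFin; apply: eq_bigr => j _; rewrite EFinM.
  under eq_integral do rewrite SE.
  have mff i j : measurable_fun setT (fun t => (f (xs i t))%:E * (f (xs j t))%:E)%E.
    by apply: emeasurable_funM; exact/measurable_EFinP.
  have ff0 i j t : (0 <= (f (xs i t))%:E * (f (xs j t))%:E)%E.
    by rewrite mule_ge0 ?lee_fin.
  rewrite ge0_integral_sum//; last 2 first.
  - by move=> i; exact: emeasurable_sum.
  - by move=> i t _; apply: sume_ge0.
  under eq_bigr do rewrite ge0_integral_sum//.
  (* The diagonal terms are raised from [q] to [q + a ^+ 2], so that the constants add up to exactly
     [(n a)^2]. *)
  apply: (@le_trans _ _ (\sum_(i < n) \sum_(j < n)
      ((if j == i then q else 0) + (a ^+ 2)%:E))%E).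
    apply: lee_sum => i _; apply: lee_sum => j _.
    have [->|ij] := eqVneq j i.
      rewrite (ge0_integral_same_law (f := fun y => (f y)%:E * (f y)%:E)%E)//.
      - under eq_integral do rewrite -EFinM -expr2.
        by rewrite leeDl// lee_fin sqr_ge0.
      - exact: emeasurable_funM.
      - by move=> y; rewrite mule_ge0 ?lee_fin.
    rewrite (ge0_integral_indepM (f := fun y => (f y)%:E) (g := fun y => (f y)%:E))//;
      last by rewrite eq_sym.
    by rewrite aE add0e -EFinM -expr2.
  rewrite (eq_bigr (fun=> q + (n%:R * a ^+ 2)%:E)%E) => [|i _].
    rewrite big_split/= sume_const_ord sumEFin sumr_const card_ord leeD//.
    by rewrite lee_fin -[X in X <= _]mulr_natl exprMn mulrA -expr2.
  rewrite big_split/= -big_mkcond big_pred1_eq sumEFin sumr_const card_ord.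
  by rewrite mulr_natl.
(* The expansion of the square is written with additions only, since the second moment of [S] may be
   infinite. *)
have key : (\int[P]_t ((S t - n%:R * a) ^+ 2)%:E + (2 * (n%:R * a) ^+ 2)%:E =
    \int[P]_t ((S t) ^+ 2)%:E + ((n%:R * a) ^+ 2)%:E)%E.
  have na0 : 0 <= 2 * (n%:R * a) by rewrite !mulr_ge0.
  have mD : measurable_fun setT (fun t => (S t - n%:R * a) ^+ 2).
    by apply: measurable_funX; exact: measurable_funB.
  transitivity (\int[P]_t (((S t - n%:R * a) ^+ 2)%:E + (2 * (n%:R * a) * S t)%:E))%E.
    rewrite ge0_integralD//.
    - under [X in (_ = _ + X)%E]eq_integral do rewrite EFinM.
      rewrite ge0_integralZl//; last by move=> t _; rewrite lee_fin.
        by rewrite ES -EFinM expr2 mulrA.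
      exact/measurable_EFinP.
    - by move=> t _; rewrite lee_fin sqr_ge0.
    - exact/measurable_EFinP.
    - by move=> t _; rewrite lee_fin mulr_ge0.
    - by apply/measurable_EFinP; exact: measurable_funM.
  transitivity (\int[P]_t (((S t) ^+ 2)%:E + ((n%:R * a) ^+ 2)%:E))%E.
    by apply: eq_integral => t _; rewrite -!EFinD; congr EFin; ring.
  rewrite ge0_integralD//.
  - by rewrite integral_cst// probability_measure1 mule1.
  - by move=> t _; rewrite lee_fin sqr_ge0.
  - by apply/measurable_EFinP; exact: measurable_funX.
  - by move=> t _; rewrite lee_fin sqr_ge0.
rewrite -(@leeD2rE _ (2 * (n%:R * a) ^+ 2)%:E)// key.
apply: (le_trans (leeD2r _ ES2)); rewrite -addeA -EFinD leeD2l// lee_fin.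
by rewrite mulr2n mulrDl !mul1r.
Qed.

Definition avg (f : X -> R) (n : nat) (t : T) : R :=
  n%:R^-1 * \sum_(i < n) f (xs i t).

(** Exchanging sum and integral turns a pointwise bound on partial sums into summability of
    expectations; so a finite first moment suffices to control truncated second moments. *)
Lemma summable_of_dominated_sum (g u : nat -> T -> R) (Z : T -> R) :
  (forall n, measurable_fun setT (u n)) -> (forall n t, 0 <= u n t) ->
  (forall m t, \sum_(0 <= n < m) u n t <= Z t) ->
  P.-integrable setT (fun t => (Z t)%:E) ->
  (forall n t, 0 <= g n t) ->
  (forall n, \int[P]_t (g n t)%:E <= \int[P]_t (u n t)%:E)%E ->
  (\sum_(n <oo) \int[P]_t (g n t)%:E < +oo)%E.
Proof.
move=> mu u0 uZ Zint g0 gu.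
apply: (@le_lt_trans _ _ (\sum_(n <oo) \int[P]_t (u n t)%:E)%E).
  apply: lee_nneseries => n *; last exact: gu.
  by apply: integral_ge0 => t _; rewrite lee_fin.
rewrite -integral_nneseries//; last 2 first.
- by move=> n; exact/measurable_EFinP.
- by move=> n t _; rewrite lee_fin.
apply: le_lt_trans (integrable_lty measurableT Zint).
apply: ge0_le_integral => //.
- by move=> t _; apply: nneseries_ge0 => n _ _; rewrite lee_fin.
- apply: ge0_emeasurable_sum => [n t _ _|n _]; first by rewrite lee_fin.
  exact/measurable_EFinP.
- exact: (measurable_int P).
- move=> t _; apply: nneseries_le_bound => [n|m]; first by rewrite lee_fin.
  by rewrite sumEFin lee_fin.
Qed.

Lemma integrable_le (f g : T -> R) : measurable_fun setT f ->
  (forall t, `|f t| <= g t) -> P.-integrable setT (fun t => (g t)%:E) ->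
  P.-integrable setT (fun t => (f t)%:E).
Proof.
move=> mf fg; apply: le_integrable => //; first exact/measurable_EFinP.
by move=> t _; rewrite !abse_EFin lee_fin (le_trans (fg t))// ler_norm.
Qed.

(* The variance bound is applied to the sums of length [2^n] truncated at level
   [2^n]; this loses a factor [2] between consecutive powers of two, which is
   harmless since the lemma is only applied to functions of small mean. *)
Lemma ae_avg_le (Z : X -> R) :
  measurable_fun setT Z -> (forall y, 0 <= Z y) ->
  P.-integrable setT (fun t => (Z (x t))%:E) ->
  {ae P, forall t, forall e : R, 0 < e ->
    \forall n \near \oo, avg Z n t <= 2 * E Z + e}.
Proof.
move=> mZ Z0 Zint.
have p0 n : 0 < 2 ^+ n :> R by rewrite exprn_gt0.
pose Zn n y := if Z y <= 2 ^+ n then Z y else 0.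
have mZn n : measurable_fun setT (Zn n).
  by apply: measurable_fun_ifT => //; exact: measurable_fun_ler.
have Zn0 n y : 0 <= Zn n y by rewrite /Zn; case: ifP.
have ZnZ n y : Zn n y <= Z y by rewrite /Zn; case: ifP.
have mZx : measurable_fun setT (fun t => Z (x t)) by exact: measurableT_comp.
have mZnx n : measurable_fun setT (fun t => Zn n (x t)) by exact: measurableT_comp.
have Znint n : P.-integrable setT (fun t => (Zn n (x t))%:E).
  by apply: integrable_le Zint => // t; rewrite ger0_norm.
have EZn n : E (Zn n) <= E Z.
  by apply: le_Rintegral => //; exact: Znint.
have Z2int : P.-integrable setT (fun t => (2 * Z (x t))%:E).
  by under eq_fun do rewrite EFinM; exact: integrableZl.
pose D n t := \sum_(i < 2 ^ n) Zn n (xs i t) - (2 ^ n)%:R * E (Zn n).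
have mD n : measurable_fun setT (D n).
  apply: measurable_funB => //; apply: measurable_sum => i.
  exact: measurableT_comp.
pose g n t := (D n t / 2 ^+ n) ^+ 2.
(* This is the variance bound [2^n (Zn n)^2] divided by [4^n], the normalisation of [g n]. *)
pose u n t := if Z (x t) <= 2 ^+ n then Z (x t) ^+ 2 / 2 ^+ n else 0.
have gcvg : {ae P, forall t, g n t @[n --> \oo] --> 0}.
  apply: ae_cvg0_of_summable.
  - by move=> n; apply: measurable_funX; exact: measurable_funM.
  - by move=> n t; exact: sqr_ge0.
  apply: (@summable_of_dominated_sum _ u (fun t => 2 * Z (x t))) => //.
  - move=> n; apply: measurable_fun_ifT => //; first exact: measurable_fun_ler.
    by apply: measurable_funM => //; exact: measurable_funX.
  - by move=> n t; rewrite /u; case: ifP => // _; rewrite divr_ge0 ?sqr_ge0 ?ltW.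
  - by move=> m t; exact: dyadic_square_sum.
  - by move=> n t; exact: sqr_ge0.
  move=> n.
  have -> : (\int[P]_t (g n t)%:E =
      ((2 ^+ n)^-1 ^+ 2)%:E * \int[P]_t ((D n t) ^+ 2)%:E)%E.
    rewrite -ge0_integralZl//.
    - by apply: eq_integral => t _; rewrite -EFinM /g exprMn mulrC.
    - by apply/measurable_EFinP; exact: measurable_funX.
    - by move=> t _; rewrite lee_fin sqr_ge0.
  have -> : (\int[P]_t (u n t)%:E =
      ((2 ^+ n)^-1 ^+ 2)%:E * ((2 ^ n)%:R%:E * \int[P]_t (Zn n (x t) ^+ 2)%:E))%E.
    rewrite muleA -EFinM -ge0_integralZl//.
    - apply: eq_integral => t _; rewrite -EFinM /u /Zn; congr EFin.
      case: ifP => _; last by rewrite expr0n mulr0.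
      by rewrite natrX; field; rewrite expf_neq0.
    - by apply/measurable_EFinP; exact: measurable_funX.
    - by move=> t _; rewrite lee_fin sqr_ge0.
  rewrite lee_pmul2l// ?lte_fin ?exprn_gt0 ?invr_gt0//.
  exact: integral_variance_le.
(* Counts the samples of the block of length [2^n] that exceed the truncation level. Its mean is
   that of [v n]; being an integer that tends to [0], the count is eventually [0], and truncation
   then leaves the block sum unchanged. *)
pose b n t : R := \sum_(i < 2 ^ n) (if 2 ^+ n < Z (xs i t) then 1 else 0).
pose v n t : R := if 2 ^+ n < Z (x t) then 2 ^+ n else 0.
have mif n : measurable_fun setT (fun y => if 2 ^+ n < Z y then 1 else 0 : R).
  by apply: measurable_fun_ifT => //; exact: measurable_fun_ltr.
have mifx n i : measurable_fun setT (fun t => if 2 ^+ n < Z (xs i t) then 1 else 0 : R).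
  by apply: (measurableT_comp (mif n)).
have bcvg : {ae P, forall t, b n t @[n --> \oo] --> 0}.
  have b0 n t : 0 <= b n t by apply: sumr_ge0 => i _; case: ifP.
  apply: ae_cvg0_of_summable => //.
  - by move=> n; apply: measurable_sum => i; exact: mifx.
  apply: (@summable_of_dominated_sum _ v (fun t => 2 * Z (x t))) => //.
  - by move=> n; apply: measurable_fun_ifT => //; exact: measurable_fun_ltr.
  - by move=> n t; rewrite /v; case: ifP => // _; exact: ltW.
  - by move=> m t; exact: dyadic_tail_sum.
  move=> n; rewrite /b; under eq_integral do rewrite -sumEFin.
  rewrite ge0_integral_sum//; last 2 first.
  - by move=> i; apply/measurable_EFinP; exact: mifx.
  - by move=> i t _; rewrite lee_fin; case: ifP.
  rewrite (eq_bigr (fun=>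
    \int[P]_t (if (2 ^+ n < Z (x t))%R then 1 else 0)%:E)%E); last first.
    move=> i _.
    apply: (ge0_integral_same_law (f := fun y => (if 2 ^+ n < Z y then 1 else 0)%:E)).
      exact/measurable_EFinP.
    by move=> y; rewrite lee_fin; case: ifP.
  rewrite sume_const_ord -ge0_integralZl//.
  - rewrite le_eqVlt; apply/orP; left; apply/eqP; apply: eq_integral => t _.
    by rewrite -EFinM /v natrX; case: ifP; rewrite ?mulr1 ?mulr0.
  - by apply/measurable_EFinP; exact: (measurableT_comp (mif n)).
  - by move=> t _; rewrite lee_fin; case: ifP.
apply: filterS2 gcvg bcvg => t gt bt e e0.
have /cvgrPdist_lt/(_ ((e / 2) ^+ 2)) := gt.
have e2 : 0 < (e / 2) ^+ 2 by rewrite exprn_gt0 ?divr_gt0.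
move=> /(_ e2) [n1 _ gn1].
have /cvgrPdist_lt/(_ 1 ltr01) [n2 _ bn2] := bt.
pose S N := \sum_(i < N) Z (xs i t).
have block n : (maxn n1 n2 <= n)%N -> S (2 ^ n)%N <= 2 ^+ n * (E Z + e / 2).
  rewrite geq_max => /andP[/gn1 /= gn /bn2 /= bn].
  have Zle i : (i < 2 ^ n)%N -> Z (xs i t) <= 2 ^+ n.
    move=> iN; rewrite leNgt; apply/negP => Zi.
    move: bn; rewrite sub0r normrN ger0_norm; last by apply: sumr_ge0 => j _; case: ifP.
    rewrite ltNge /b (bigD1 (Ordinal iN))//= Zi lerDl => /negP; apply.
    by apply: sumr_ge0 => j _; case: ifP.
  have SE : S (2 ^ n)%N = \sum_(i < 2 ^ n) Zn n (xs i t).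
    by apply: eq_bigr => i _; rewrite /Zn Zle.
  have {}gn : D n t / 2 ^+ n <= e / 2.
    apply: (le_trans (ler_norm _)); apply: norm_le_of_sqr; first lra.
    by move: gn; rewrite sub0r normrN ger0_norm; [exact: ltW|exact: sqr_ge0].
  rewrite ler_pdivrMr// in gn; rewrite SE.
  have := EZn n; rewrite -(ler_pM2l (p0 n)); move: gn; rewrite /D natrX; lra.
exists (2 ^ maxn n1 n2)%N => // N /= NN.
have N0 : (0 < N)%N by rewrite (leq_trans _ NN)// expn_gt0.
have /andP[lo hi] := trunc_log_bounds (isT : (1 < 2)%N) N0.
set n := trunc_log 2 N in lo hi.
have nn : (maxn n1 n2 <= n.+1)%N by rewrite ltnW// ltnS; exact: trunc_log_max.
rewrite /avg ler_pdivrMl ?ltr0n//.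
apply: (le_trans (ler_sum_ord (f := fun i => Z (xs i t)) _ (ltnW hi))) => //.
apply: (le_trans (block _ nn)).
have EZ0 : 0 <= E Z by exact: Rintegral_ge0.
have : 2 ^+ n.+1 <= 2 * N%:R :> R by rewrite exprS ler_pM2l// -natrX ler_nat.
have : 0 <= E Z + e / 2 by lra.
move=> h1 h2; have := ler_wpM2r h1 h2; lra.
Qed.

(* Along the squares the variances are summable, and the sums move by at most
   [2 m c] between two consecutive squares. *)
Lemma strong_law_bounded (f : X -> R) (c : R) :
  measurable_fun setT f -> (forall y, 0 <= f y <= c) ->
  {ae P, forall t, avg f n t @[n --> \oo] --> E f}.
Proof.
move=> mf fc.
have f0 y : 0 <= f y by case/andP: (fc y).
have fint : P.-integrable setT (fun t => (f (x t))%:E).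
  apply: (@integrable_le _ (fun=> c)); first exact: measurableT_comp.
    by move=> t; rewrite ger0_norm//; case/andP: (fc (x t)).
  exact: finite_measure_integrable_cst.
set a := E f.
have a0 : 0 <= a by exact: Rintegral_ge0.
have ac : a <= c.
  have -> : c = Rintegral P setT (fun=> c).
    by rewrite Rintegral_cst// probability_measure1 mulr1.
  apply: le_Rintegral => //; first exact: finite_measure_integrable_cst.
  by move=> t _; case/andP: (fc (x t)).
pose D n t := \sum_(i < n) f (xs i t) - n%:R * a.
have mD n : measurable_fun setT (D n).
  apply: measurable_funB => //; apply: measurable_sum => i.
  exact: measurableT_comp.
pose g n t := (D (n.+1 ^ 2)%N t / (n.+1 ^ 2)%:R) ^+ 2.
have gcvg : {ae P, forall t, g n t @[n --> \oo] --> 0}.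
  apply: ae_cvg0_of_summable.
  - by move=> n; apply: measurable_funX; exact: measurable_funM.
  - by move=> n t; exact: sqr_ge0.
  apply: (@summable_of_dominated_sum _ (fun n _ => c ^+ 2 / n.+1%:R ^+ 2)
    (fun=> 2 * c ^+ 2)) => //.
  - by move=> n t; rewrite divr_ge0// sqr_ge0.
  - move=> m _.
    by rewrite -mulr_sumr mulrC ler_wpM2r ?sqr_ge0// ler_sum_invr_sqr.
  - exact: finite_measure_integrable_cst.
  - by move=> n t; exact: sqr_ge0.
  move=> n; set N := (n.+1 ^ 2)%N.
  have -> : (\int[P]_t (g n t)%:E =
      (N%:R^-1 ^+ 2)%:E * \int[P]_t ((D N t) ^+ 2)%:E)%E.
    rewrite -ge0_integralZl//.
    - by apply: eq_integral => t _; rewrite -EFinM /g exprMn mulrC.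
    - by apply/measurable_EFinP; exact: measurable_funX.
    - by move=> t _; rewrite lee_fin sqr_ge0.
  have Np : 0 < N%:R :> R by rewrite ltr0n expn_gt0.
  apply: (@le_trans _ _ ((N%:R^-1 ^+ 2)%:E * (N%:R%:E * (c ^+ 2)%:E))%E).
    rewrite lee_pmul2l// ?lte_fin ?exprn_gt0 ?invr_gt0//.
    apply: (le_trans (integral_variance_le _ mf f0 fint)).
    rewrite lee_pmul2l// ?lte_fin//.
    apply: (@le_trans _ _ (\int[P]_t (c ^+ 2)%:E)%E).
      apply: ge0_le_integral => //.
      - by move=> t _; rewrite lee_fin sqr_ge0.
      - by apply/measurable_EFinP; apply: measurable_funX; exact: measurableT_comp.
      - move=> t _; rewrite lee_fin; case/andP: (fc (x t)) => h1 h2.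
        by rewrite ler_pXn2r// nnegrE (le_trans h1).
    by rewrite integral_cst// probability_measure1 mule1.
  rewrite integral_cst// probability_measure1 mule1 -!EFinM lee_fin.
  rewrite /N natrX le_eqVlt; apply/orP; left; apply/eqP; field.
  by rewrite nat1r pnatr_eq0.
apply: filterS gcvg => t gt.
apply/cvgrPdist_le => e e0.
have /cvgrPdist_lt/(_ ((e / 2) ^+ 2)) := gt.
have e2 : 0 < (e / 2) ^+ 2 by rewrite exprn_gt0 ?divr_gt0.
move=> /(_ e2) [n1 _ gn1].
have c0 : 0 <= c by case/andP: (fc (x t)) => h1 h2; exact: le_trans h2.
(* Between the squares around [N] the centred sums move by at most [2 (m + 1) c]; with
   [4 c <= (m + 1) e] and [(m + 1)^2 <= N] this is at most [N e / 2]. *)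
have [n2 n2c] : exists n2 : nat, 4 * c < n2.+1%:R * e.
  have c1 : 0 < 4 * c + 1 by lra.
  have [n2 _ /(_ _ (leqnn n2))] : \forall n \near \oo, n.+1%:R^-1 < e / (4 * c + 1).
    by apply: near_infty_natSinv_lt (PosNum _); rewrite divr_gt0.
  rewrite ltr_pdivlMr// ltr_pdivrMl ?ltr0n// => h.
  by exists n2; apply: lt_trans h; rewrite ltrDl.
exists ((maxn n1 n2).+1 ^ 2)%N => // N /= NN.
have N0 : (0 < N)%N by rewrite (leq_trans _ NN)// expn_gt0.
have [m /andP[lo hi]] := floor_sqrt N.
have mm : (maxn n1 n2 < m)%N.
  by have := leq_ltn_trans NN hi; rewrite ltn_exp2r.
case: m lo hi mm => // m lo hi; rewrite ltnS geq_max => /andP[m1 m2].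
have Np : 0 < N%:R :> R by rewrite ltr0n.
have Dm : `|D (m.+1 ^ 2)%N t| <= (m.+1 ^ 2)%:R * (e / 2).
  have := gn1 m m1; rewrite /= sub0r normrN ger0_norm; last exact: sqr_ge0.
  move=> /ltW gm; have e20 : 0 <= e / 2 by lra.
  have := norm_le_of_sqr e20 gm.
  by rewrite normrM normfV normr_nat ler_pdivrMr ?ltr0n ?expn_gt0// mulrC.
have DN : `|D N t - D (m.+1 ^ 2)%N t| <= (N - m.+1 ^ 2)%:R * c.
  have -> : D N t - D (m.+1 ^ 2)%N t = \sum_(m.+1 ^ 2 <= i < N) (f (xs i t) - a).
    rewrite /D -!(big_mkord xpredT (fun i => f (xs i t))).
    rewrite (big_cat_nat (m := 0) (n := (m.+1 ^ 2)%N) (p := N))//= sumrB sumr_const_nat.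
    rewrite -[in N%:R * a](subnKC lo) natrD -mulr_natl; ring.
  apply: (le_trans (ler_norm_sum _ _ _)).
  rewrite mulr_natl -sumr_const_nat; apply: ler_sum => i _.
  rewrite ler_norml; case/andP: (fc (xs i t)) => h1 h2; apply/andP; split; lra.
have Nm : (N - m.+1 ^ 2)%:R <= 2 * m.+1%:R :> R.
  rewrite -natrM ler_nat leq_subLR; move: hi; rewrite !expnS !expn0 !muln1 => hi.
  lia.
have m2N : m.+1%:R * m.+1%:R <= N%:R :> R by rewrite -natrM ler_nat mulnn.
rewrite /avg.
have -> : a - N%:R^-1 * \sum_(i < N) f (xs i t) = - (D N t / N%:R).
  by rewrite /D; field; rewrite gt_eqF.
rewrite normrN normrM normfV (ger0_norm (ltW Np)) ler_pdivrMr//.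
have -> : D N t = D (m.+1 ^ 2)%N t + (D N t - D (m.+1 ^ 2)%N t) by rewrite addrC subrK.
apply: (le_trans (ler_normD _ _)); apply: (le_trans (lerD Dm DN)).
have h1 : (m.+1 ^ 2)%:R * (e / 2) <= N%:R * (e / 2).
  by rewrite ler_wpM2r ?ler_nat// divr_ge0// ltW.
have h2 : (N - m.+1 ^ 2)%:R * c <= 2 * m.+1%:R * c by rewrite ler_wpM2r.
have h3 : 4 * c <= e * m.+1%:R.
  rewrite [e * _]mulrC (le_trans (ltW n2c))//.
  by rewrite ler_pM2r// ler_nat.
have h4 : 4 * c * m.+1%:R <= e * m.+1%:R * m.+1%:R by rewrite ler_wpM2r.
have h5 : e * (m.+1%:R * m.+1%:R) <= e * N%:R by rewrite ler_wpM2l// ltW.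
lra.
Qed.

Lemma avgD (f g : X -> R) n t : avg (fun y => f y + g y) n t = avg f n t + avg g n t.
Proof. by rewrite /avg big_split/= mulrDr. Qed.

Lemma avgN (f : X -> R) n t : avg (fun y => - f y) n t = - avg f n t.
Proof. by rewrite /avg sumrN mulrN. Qed.

(** Cutting at a fixed level [k] leaves a bounded part, covered by the bounded law, and a tail whose
    averages are eventually below about twice its mean. That mean tends to [0] with [k], so the
    factor two disappears in the limit. *)
Lemma strong_law_ge0 (f : X -> R) :
  measurable_fun setT f -> (forall y, 0 <= f y) ->
  P.-integrable setT (fun t => (f (x t))%:E) ->
  {ae P, forall t, avg f n t @[n --> \oo] --> E f}.
Proof.
move=> mf f0 fint.
have mfx : measurable_fun setT (fun t => f (x t)) by exact: measurableT_comp.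
pose lo (k : nat) y := if f y <= k%:R then f y else 0.
pose hi (k : nat) y := if f y <= k%:R then 0 else f y.
have fE k : f = (fun y => lo k y + hi k y).
  by apply/funext => y; rewrite /lo /hi; case: ifP; rewrite ?addr0 ?add0r.
have mlo k : measurable_fun setT (lo k).
  by apply: measurable_fun_ifT => //; exact: measurable_fun_ler.
have mhi k : measurable_fun setT (hi k).
  by apply: measurable_fun_ifT => //; exact: measurable_fun_ler.
have lo0 k y : 0 <= lo k y <= k%:R.
  by rewrite /lo; case: ifP => [->|_]; rewrite ?f0 ?lexx ?ler0n.
have hi0 k y : 0 <= hi k y by rewrite /hi; case: ifP.
have hif k y : hi k y <= f y by rewrite /hi; case: ifP.
have lof k y : lo k y <= f y by rewrite /lo; case: ifP.
have loint k : P.-integrable setT (fun t => (lo k (x t))%:E).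
  apply: integrable_le fint; first exact: measurableT_comp.
  by move=> t; rewrite ger0_norm//; case/andP: (lo0 k (x t)).
have hiint k : P.-integrable setT (fun t => (hi k (x t))%:E).
  by apply: integrable_le fint; [exact: measurableT_comp|move=> t; rewrite ger0_norm].
have Ehi : E (hi k) @[k --> \oo] --> 0.
  have [|||||_ _ cv] := @dominated_convergence _ _ _ P setT measurableT
    (fun k t => (hi k (x t))%:E) (cst 0%E) (fun t => (f (x t))%:E).
  - by move=> k; apply/measurable_EFinP; exact: measurableT_comp.
  - by [].
  - apply: aeW => t _; apply: cvg_near_cst.
    near=> k; rewrite /hi ifT//; near: k; exact: nbhs_infty_ger.
  - exact: fint.
  - by apply: aeW => t k _; rewrite abse_EFin lee_fin ger0_norm.
  by move: cv; rewrite integral0 => /fine_cvg.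
have Hlo := ae_foralln (fun k => strong_law_bounded (mlo k) (lo0 k)).
have Hhi := ae_foralln (fun k => ae_avg_le (mhi k) (hi0 k) (hiint k)).
apply: filterS2 Hlo Hhi => t Hlo Hhi.
apply/cvgrPdist_le => e e0.
have e5 : 0 < e / 5 by lra.
have /cvgrPdist_lt/(_ _ e5) [k _ /(_ _ (leqnn k))] := Ehi.
rewrite /= sub0r normrN => Ek.
have Ek' := le_lt_trans (ler_norm _) Ek.
have EfE : E f = E (lo k) + E (hi k).
  rewrite -(RintegralD measurableT (loint k) (hiint k)).
  by apply: eq_Rintegral => y _; rewrite {1}(fE k).
near=> n.
have h1 : `|E (lo k) - avg (lo k) n t| <= e / 5.
  by near: n; have /cvgrPdist_le := Hlo k; apply.
have h2 : avg (hi k) n t <= 2 * E (hi k) + e / 5 by near: n; exact: Hhi.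
have h3 : 0 <= avg (hi k) n t by rewrite /avg mulr_ge0 ?invr_ge0// sumr_ge0.
have h4 : 0 <= E (hi k) by exact: Rintegral_ge0.
have -> : avg f n t = avg (lo k) n t + avg (hi k) n t by rewrite -avgD -fE.
rewrite EfE; move: h1; rewrite !ler_norml => /andP[h5 h6].
by apply/andP; split; lra.
Unshelve. all: by end_near. Qed.

Theorem strong_law (f : X -> R) :
  measurable_fun setT f -> P.-integrable setT (fun t => (f (x t))%:E) ->
  {ae P, forall t, avg f n t @[n --> \oo] --> E f}.
Proof.
move=> mf fint.
pose fp y := Num.max (f y) 0; pose fm y := Num.max (- f y) 0.
have fE : f = (fun y => fp y + - fm y).
  apply/funext => y; rewrite /fp /fm.
  have [h|h] := leP (f y) 0; have [h'|h'] := leP (- f y) 0; lra.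
have mp : measurable_fun setT fp by exact: measurable_maxr.
have mm : measurable_fun setT fm.
  by apply: measurable_maxr => //; exact: measurableT_comp.
have p0 y : 0 <= fp y by rewrite /fp le_max lexx orbT.
have m0 y : 0 <= fm y by rewrite /fm le_max lexx orbT.
have nint : P.-integrable setT (fun t => `|f (x t)|%:E) by exact: integrable_norm.
have pint : P.-integrable setT (fun t => (fp (x t))%:E).
  apply: integrable_le nint; first exact: measurableT_comp.
  by move=> t; rewrite ger0_norm// /fp ge_max ler_norm normr_ge0.
have mint : P.-integrable setT (fun t => (fm (x t))%:E).
  apply: integrable_le nint; first exact: measurableT_comp.
  by move=> t; rewrite ger0_norm// /fm ge_max -normrN ler_norm normr_ge0.
have EfE : E f = E fp - E fm.
  rewrite -(RintegralB measurableT pint mint).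
  by apply: eq_Rintegral => y _; rewrite {1}fE.
apply: filterS2 (strong_law_ge0 mp p0 pint) (strong_law_ge0 mm m0 mint) => t hp hm.
rewrite EfE fE; under eq_fun do rewrite avgD avgN.
exact: cvgB.
Qed.

End strong_law.

(** * A uniform strong law on compact sets *)

(** Without a finite net, the points of [K] away from finitely many centres generate a proper
    filter. It would cluster at some [p] in [K], yet it contains the set of points away from [p]
    itself. *)
Lemma compact_finite_net {R : realType} {M : pseudoMetricType R} (K : set M) (e : R) :
  compact K -> 0 < e -> exists s : seq M,
    (forall x, x \in s -> K x) /\
    (forall y, K y -> exists2 x, x \in s & ball x e y).
Proof.
move=> cK e0; apply: contrapT => H.
pose away (s : seq M) := [set y | K y /\ forall x, x \in s -> ~ ball x e y].
pose F : set_system M :=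
  [set A | exists2 s : seq M, (forall x, x \in s -> K x) & away s `<=` A].
have FF : ProperFilter F.
  apply: Build_ProperFilter_ex.
    move=> A [s sK sA]; apply: contrapT => A0; apply: H; exists s; split => // y Ky.
    apply: contrapT => ny; apply: A0; exists y; apply: sA; split => // x xs xy.
    by apply: ny; exists x.
  split.
  - by exists [::].
  - move=> A B [s sK sA] [r rK rB]; exists (s ++ r).
      by move=> x; rewrite mem_cat => /orP[/sK|/rK].
    move=> y [Ky yP]; split; [apply: sA|apply: rB]; split => // x xs;
      by apply: yP; rewrite mem_cat xs ?orbT.
  - by move=> A B AB [s sK sA]; exists s => //; exact: subset_trans AB.
have [|p [Kp clp]] := cK F FF; first by exists [::] => // y [].
have [|y [[_ yP] yb]] := clp (away [:: p]) (ball p e) _ (nbhsx_ballx p e e0).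
  by exists [:: p] => // x; rewrite inE => /eqP ->.
by apply: (yP p) => //; rewrite inE.
Qed.

(** Continuity is relative to [K] only. Pairs violating uniformity at scale [1 / (n + 1)] have first
    entries converging along an ultrafilter to some [p] in [K]; both entries then come close to
    [p]. *)
Lemma compact_uniform_continuous {R : realType} {M : pseudoMetricType R} (K : set M)
    (f : M -> R) : compact K ->
  (forall p, K p -> forall e : R, 0 < e -> exists2 del : R, 0 < del &
     forall q, K q -> ball p del q -> `|f q - f p| < e) ->
  forall e : R, 0 < e -> exists2 del : R, 0 < del &
    forall p q, K p -> K q -> ball p del q -> `|f p - f q| < e.
Proof.
move=> cK fc e e0; apply: contrapT => H.
have /choice[a aP] (n : nat) : exists ab : M * M,
    [/\ K ab.1, K ab.2, ball ab.1 n.+1%:R^-1 ab.2 & e <= `|f ab.1 - f ab.2|].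
  apply: contrapT => nab; apply: H; exists n.+1%:R^-1; first by rewrite invr_gt0.
  move=> p q Kp Kq pq; rewrite ltNge; apply/negP => le; apply: nab.
  by exists (p, q).
have [G [UG sG]] := ultraFilterLemma (@eventually_filter).
have GK : \forall n \near G, K (a n).1.
  by apply: sG; exists 0%N => // n _; have [] := aP n.
have [p Kp ap] := compact_ultra_cvg UG cK GK.
have e2 : 0 < e / 2 by lra.
have [del del0 fp] := fc p Kp _ e2.
have del2 : 0 < del / 2 by lra.
have h1 : \forall n \near G, ball p (del / 2) (a n).1.
  by apply: ap; exact: nbhsx_ballx.
have h2 : \forall n \near G, n.+1%:R^-1 < del / 2.
  by apply: sG; exact: (near_infty_natSinv_lt (PosNum del2)).
have [n [h3 h4]] : exists n, ball p (del / 2) (a n).1 /\ n.+1%:R^-1 < del / 2.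
  by apply: (@filter_ex _ G); exact: filterI.
have [K1 K2 b12 le] := aP n.
have f1 : `|f (a n).1 - f p| < e / 2.
  by apply: fp => //; apply: le_ball h3; lra.
have f2 : `|f (a n).2 - f p| < e / 2.
  apply: fp => //; rewrite (splitr del); apply: ball_triangle h3 _.
  exact: le_ball (ltW h4) _ b12.
have : `|f (a n).1 - f (a n).2| < e.
  have -> : f (a n).1 - f (a n).2 = (f (a n).1 - f p) - (f (a n).2 - f p) by ring.
  by apply: (le_lt_trans (ler_normB _ _)); lra.
by rewrite ltNge le.
Qed.

Section uniform_law.
Context {R : realType} {d d' : measure_display}.
Variables (T : measurableType d) (X : measurableType d') (P : probability T R).
Variables (x : T -> X) (xs : nat -> T -> X).
Hypothesis mx : measurable_fun setT x.
Hypothesis mxs : forall i, measurable_fun setT (xs i).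
Hypothesis indep : indep_seq P xs.
Hypothesis law : forall i, same_law P (xs i) x.
Local Notation E f := (Rintegral P setT (fun t => f (x t))).

Lemma avg_dist_le (f g w : X -> R) n t : (forall y, `|f y - g y| <= w y) ->
  `|avg xs f n t - avg xs g n t| <= avg xs w n t.
Proof.
move=> fgw; rewrite /avg -mulrBr -sumrB normrM normfV normr_nat.
rewrite ler_wpM2l ?invr_ge0//; apply: (le_trans (ler_norm_sum _ _ _)).
by apply: ler_sum.
Qed.

Lemma mean_dist_le (f g w : X -> R) : (forall y, `|f y - g y| <= w y) ->
  P.-integrable setT (fun t => (f (x t))%:E) ->
  P.-integrable setT (fun t => (g (x t))%:E) ->
  P.-integrable setT (fun t => (w (x t))%:E) ->
  `|E f - E g| <= E w.
Proof.
move=> fgw fi gi wi; rewrite -RintegralB//.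
have fgi : P.-integrable setT (EFin \o (fun t => f (x t) - g (x t))).
  have := integrableB measurableT fi gi.
  by apply: eq_integrable => // t _ /=; rewrite EFinB.
apply: (le_trans (le_normr_Rintegral measurableT fgi)).
apply: le_Rintegral => //; exact: integrable_norm fgi.
Qed.

Variables (M : pseudoMetricType R) (K : set M).
Hypothesis cK : compact K.
Variables (h : M -> X -> R) (z : X -> R).
Hypothesis mh : forall m, K m -> measurable_fun setT (h m).
Hypothesis hc : forall y p, K p -> forall e : R, 0 < e ->
  exists2 del : R, 0 < del &
    forall q, K q -> ball p del q -> `|h q y - h p y| < e.
Hypothesis hz : forall m y, K m -> `|h m y| <= z y.
Hypothesis zint : P.-integrable setT (fun t => (z (x t))%:E).

(* The modulus of continuity over a countable dense subset of [K] is a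
   measurable random variable whose mean tends to [0]; the strong law for it and
   for the dense set controls all of [K]. *)
Theorem uniform_law : {ae P, forall t, forall e : R, 0 < e ->
  \forall n \near \oo, forall m, K m -> `|avg xs (h m) n t - E (h m)| <= e}.
Proof.
have [->|/set0P[k0 Kk0]] := eqVneq K set0; first by apply: aeW => t e e0; exact: nearW.
have /choice[s sP] (k : nat) : exists s : seq M, (forall x, x \in s -> K x) /\
    (forall y, K y -> exists2 x, x \in s & ball x k.+1%:R^-1 y).
  by apply: compact_finite_net => //; rewrite invr_gt0.
(* One sequence [D] enumerates all the nets [s k]. Numbers that code no pair are read as [(0, 0)]
   and positions past the end of a net give [k0], so [D] always stays in [K]. *)
pose code (n : nat) : nat * nat := odflt (0%N, 0%N) (unpickle n).
have codeK ki : code (pickle ki) = ki by rewrite /code pickleK.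
pose dd ki := nth k0 (s ki.1) ki.2.
pose D n := dd (code n).
have KD n : K (D n).
  rewrite /D /dd; have [lt|le] := ltnP (code n).2 (size (s (code n).1)).
    by apply: (sP _).1; exact: mem_nth.
  by rewrite nth_default.
have net k m : K m -> exists2 i, (i < size (s k))%N & ball (dd (k, i)) k.+1%:R^-1 m.
  move=> Km; have [_ /(_ m Km)[q qs qm]] := sP k.
  by exists (index q (s k)); rewrite ?index_mem// /dd nth_index.
have ddD ki : dd ki = D (pickle ki) by rewrite /D codeK.
have dense m (del : R) : K m -> 0 < del -> exists n, ball m del (D n).
  move=> Km del0.
  have [k _ /(_ _ (leqnn k)) kd] := near_infty_natSinv_lt (PosNum del0).
  have [i _ b] := net k m Km; exists (pickle (k, i)); rewrite -ddD.
  by apply: ball_sym; apply: le_ball b; exact: ltW.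
(* Here [n] codes a pair of points of [D], and pairs farther apart than [1 / (k + 1)] count as [0].
   The supremum over [n], which is [om k] below, is the modulus of continuity over a countable set,
   hence measurable. *)
pose w (k n : nat) y : R := if `[< ball (D (code n).1) k.+1%:R^-1 (D (code n).2) >]
  then `|h (D (code n).1) y - h (D (code n).2) y| else 0.
have w0 k n y : 0 <= w k n y by rewrite /w; case: ifP.
have z0 y : 0 <= z y by apply: le_trans (hz y Kk0).
have wz k n y : w k n y <= 2 * z y.
  rewrite /w; case: ifP => _; last by rewrite mulr_ge0.
  apply: (le_trans (ler_normB _ _)).
  by have := hz y (KD (code n).1); have := hz y (KD (code n).2); lra.
have mw k n : measurable_fun setT (w k n).
  rewrite /w; case: `[< _ >] => //; apply: measurableT_comp => //.
  by apply: measurable_funB; exact: mh.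
have hub k y : has_ubound (range (fun n => w k n y)) by exists (2 * z y) => _ [n _ <-].
pose om k y := sups (fun n => w k n y) 0.
have omE k y : om k y = sup (range (fun n => w k n y)).
  rewrite /om /sups/= /sdrop; congr sup.
  by apply/seteqP; split => [_ [n _ <-]|_ [n _ <-]]; exists n.
have mom k : measurable_fun setT (om k).
  by apply: measurable_fun_sups => // y _; exact: hub.
have wom k n y : w k n y <= om k y.
  by rewrite omE; apply: ub_le_sup => //; exists n.
have omub k y c : (forall n, w k n y <= c) -> om k y <= c.
  move=> wc; rewrite omE; apply: ge_sup; first by exists (w k 0%N y), 0%N.
  by move=> _ [n _ <-].
have om0 k y : 0 <= om k y by exact: le_trans (w0 k 0%N y) (wom k 0%N y).
have omz k y : om k y <= 2 * z y by exact: omub.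
have z2int : P.-integrable setT (fun t => (2 * z (x t))%:E).
  by under eq_fun do rewrite EFinM; exact: integrableZl.
have omint k : P.-integrable setT (fun t => (om k (x t))%:E).
  by apply: integrable_le z2int; [exact: measurableT_comp|move=> t; rewrite ger0_norm].
have om_cvg y : om k y @[k --> \oo] --> 0.
  apply/cvgrPdist_le => e e0.
  have [del del0 uc] := compact_uniform_continuous cK (hc y) e0.
  have := near_infty_natSinv_lt (PosNum del0); apply: filterS => k /= kd.
  rewrite sub0r normrN ger0_norm//; apply: omub => n; rewrite /w.
  case: ifPn => [/asboolP b|_]; last exact: ltW.
  by apply/ltW/uc => //; apply: le_ball b; exact: ltW.
have Eom : E (om k) @[k --> \oo] --> 0.
  have [|||||_ _ cv] := @dominated_convergence _ _ _ P setT measurableT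
    (fun k t => (om k (x t))%:E) (cst 0%E) (fun t => (2 * z (x t))%:E).
  - by move=> k; apply/measurable_EFinP; exact: measurableT_comp.
  - by [].
  - by apply: aeW => t _; apply: cvg_EFin; [exact: nearW|exact: om_cvg].
  - exact: z2int.
  - by apply: aeW => t k _; rewrite abse_EFin lee_fin ger0_norm.
  by move: cv; rewrite integral0 => /fine_cvg.
have close k n m y : K m -> ball (D n) (k.*2.+1).+1%:R^-1 m ->
    `|h m y - h (D n) y| <= om k y.
  move=> Km b; apply/ler_addgt0Pl => e e0.
  have [del del0 hdel] := hc y Km e0.
  have r0 : 0 < Num.min del (k.*2.+1).+1%:R^-1 by rewrite lt_min del0 invr_gt0 ltr0n.
  have [j bj] := dense m _ Km r0.
  have h1 : `|h (D j) y - h m y| < e.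
    by apply: hdel => //; apply: le_ball bj; rewrite ge_min lexx.
  have h2 : `|h (D n) y - h (D j) y| <= om k y.
    have := wom k (pickle (n, j)) y; rewrite /w codeK/= ifT//.
    apply/asboolP.
    have -> : k.+1%:R^-1 = (k.*2.+1).+1%:R^-1 + (k.*2.+1).+1%:R^-1 :> R.
      have -> : (k.*2.+1).+1 = (k.+1 * 2)%N by lia.
      by rewrite natrM; field; rewrite nat1r pnatr_eq0.
    apply: ball_triangle b _; apply: le_ball bj.
    by rewrite ge_min lexx orbT.
  have -> : h m y - h (D n) y = - (h (D j) y - h m y) - (h (D n) y - h (D j) y) by ring.
  by rewrite (le_trans (ler_normB _ _))// normrN lerD// ltW.
have hint m : K m -> P.-integrable setT (fun t => (h m (x t))%:E).
  move=> Km; apply: integrable_le zint; first by apply: measurableT_comp => //; exact: mh.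
  by move=> t; exact: hz.
have L1 := ae_foralln (fun n => strong_law mx mxs indep law (mh (KD n)) (hint _ (KD n))).
have L2 := ae_foralln (fun k => strong_law mx mxs indep law (mom k) (omint k)).
apply: filterS2 L1 L2 => t L1 L2 e e0.
have e5 : 0 < e / 5 by lra.
have /cvgrPdist_lt/(_ _ e5) [k _ /(_ _ (leqnn k))] := Eom.
rewrite /= sub0r normrN ger0_norm; last exact: Rintegral_ge0.
move=> Ek.
near=> n => m Km.
(* This net has radius half of [1 / (k + 1)], as [close] demands. Being finite, it admits one rank
   [n] for all its points; passing from the net point to [m] costs the average and the mean of
   [om k]. *)
have [i ilt bi] := net k.*2.+1 m Km.
have h1 : `|avg xs (h (dd (k.*2.+1, i))) n t - E (h (dd (k.*2.+1, i)))| <= e / 5.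
  have : forall i : 'I_(size (s k.*2.+1)),
    `|avg xs (h (dd (k.*2.+1, val i))) n t - E (h (dd (k.*2.+1, val i)))| <= e / 5.
    near: n; apply: filter_forall => j; rewrite ddD.
    have /cvgrPdist_le/(_ _ e5) := L1 (pickle (k.*2.+1, val j)).
    by apply: filterS => n; rewrite distrC.
  by move=> /(_ (Ordinal ilt)).
have h2 : `|E (om k) - avg xs (om k) n t| <= e / 5.
  by near: n; have /cvgrPdist_le := L2 k; apply.
have cl y : `|h m y - h (dd (k.*2.+1, i)) y| <= om k y.
  by rewrite ddD; apply: close => //; rewrite -ddD.
have h3 := avg_dist_le n t cl.
have h4 := mean_dist_le cl (hint _ Km) _ (omint k).
have {}h4 := h4 (hint (dd (k.*2.+1, i)) _).
have {}h4 : `|E (h m) - E (h (dd (k.*2.+1, i)))| <= E (om k).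
  by apply: h4; rewrite ddD.
move: h1 h2 h3 h4; rewrite !ler_norml => /andP[? ?] /andP[? ?] /andP[? ?] /andP[? ?].
by apply/andP; split; lra.
Unshelve. all: by end_near. Qed.

End uniform_law.

(** * Dual elements and the gap functional *)

Section dual.
Context {R : realType} {W : normedModType R}.
Implicit Types phi chi : W -> R.

Lemma dual_elem_of_bound phi C :
  (forall a x y, phi (a *: x + y) = a * phi x + phi y) ->
  (forall v, `|phi v| <= C * `|v|) -> dual_elem phi.
Proof.
move=> lin bd; split => // x; apply/cvgrPdist_lt => e e0.
have C1 : 0 < `|C| + 1 by rewrite ltr_wpDl.
near=> y.
have -> : phi x - phi y = phi (x - y).
  by rewrite addrC -mulN1r -lin scaleN1r addrC.
apply: (le_lt_trans (bd _)).
have : `|x - y| < e / (`|C| + 1).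
  by near: y; apply: cvgr_dist_lt => //; rewrite divr_gt0.
rewrite ltr_pdivlMr// mulrC; apply: le_lt_trans.
by rewrite ler_wpM2r//; have := ler_norm C; lra.
Unshelve. all: by end_near. Qed.

Section dual_elem.
Variable phi : W -> R.
Hypothesis dphi : dual_elem phi.

Lemma dual_elemP a x y : phi (a *: x + y) = a * phi x + phi y.
Proof. by case: dphi. Qed.

Lemma dual_elem0 : phi 0 = 0.
Proof. by have := dual_elemP 1 0 0; rewrite scaler0 addr0; lra. Qed.

Lemma dual_elemD x y : phi (x + y) = phi x + phi y.
Proof. by rewrite -[x]scale1r dual_elemP mul1r scale1r. Qed.

Lemma dual_elemZ a x : phi (a *: x) = a * phi x.
Proof. by rewrite -[a *: x]addr0 dual_elemP dual_elem0 addr0. Qed.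

Lemma dual_elemB x y : phi (x - y) = phi x - phi y.
Proof. by rewrite dual_elemD -scaleN1r dual_elemZ mulN1r. Qed.

(** The real supremum in [dnorm] is an upper bound only if the set is bounded above. Continuity at
    [0] ensures this: if [|phi| < 1] on the ball of radius [del], then [2 / del] is a bound on the
    unit ball. *)
Lemma dnorm_ub v : `|phi v| <= dnorm phi * `|v|.
Proof.
have [del del0 delP] : exists2 del : R, 0 < del & forall v, `|v| < del -> `|phi v| < 1.
  have [_ /(_ 0)] := dphi; rewrite /continuous_at dual_elem0 => /cvgrPdist_lt/(_ 1 ltr01).
  move=> /nbhs_ballP[del /= del0 delP]; exists del => // u udel.
  have := delP u; rewrite -ball_normE/= sub0r normrN => /(_ udel).
  by rewrite sub0r normrN.
have ub : has_ubound [set `|phi v| | v in [set v : W | `|v| <= 1]].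
  exists (2 / del) => _ [u /= u1 <-].
  have : `|(del / 2) *: u| < del.
    rewrite normrZ ger0_norm; last lra.
    have : del / 2 * `|u| <= del / 2 * 1 by rewrite ler_wpM2l//; lra.
    lra.
  move/delP; rewrite dual_elemZ normrM ger0_norm; last lra.
  have -> : del / 2 = (2 / del)^-1 by rewrite invf_div.
  by rewrite ltr_pdivrMl ?divr_gt0// mulr1 => /ltW.
have [->|v0] := eqVneq v 0; first by rewrite dual_elem0 !normr0 mulr0.
have vp : 0 < `|v| by rewrite normr_gt0.
have : `|phi (`|v|^-1 *: v)| <= dnorm phi.
  apply: ub_le_sup => //; exists (`|v|^-1 *: v) => //=.
  by rewrite normrZ normfV normr_id mulVf// gt_eqF.
by rewrite dual_elemZ normrM normfV normr_id ler_pdivrMl// mulrC.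
Qed.

End dual_elem.

Lemma dual_elem_dsub phi chi : dual_elem phi -> dual_elem chi -> dual_elem (dsub phi chi).
Proof.
move=> dp dc; split.
  by move=> a x y; rewrite /dsub (dual_elemP dp) (dual_elemP dc); ring.
by move=> x; apply: cvgB; [case: dp => _; apply|case: dc => _; apply].
Qed.

(** Through these half-spaces, Borel measurability into the dual yields measurability of the real
    functions [x |-> Dwf w x v]. *)
Lemma dual_open_eval_lt (v : W) a : dual_open [set phi : W -> R | phi v < a].
Proof.
move=> phi dphi /= phia.
have v1 : 0 < `|v| + 1 by rewrite ltr_wpDl.
exists ((a - phi v) / (`|v| + 1)); first by rewrite divr_gt0// subr_gt0.
move=> chi dchi; rewrite ltr_pdivlMr// => lt.
have := dnorm_ub (dual_elem_dsub dchi dphi) v.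
have := ler_norm (dsub chi phi v); rewrite /dsub => h1 h2.
move: lt h2; rewrite /dsub mulrDr mulr1.
have [h3|h3] := leP 0 (dnorm (fun v => chi v - phi v)).
  by lra.
have := mulr_le0_ge0 (ltW h3) (normr_ge0 v); lra.
Qed.

Lemma measurable_dual_eval {d} {X : measurableType d} (G : X -> W -> R) v :
  (forall S : set (W -> R), dual_open S -> measurable (G @^-1` S)) ->
  measurable_fun setT (fun x => G x v).
Proof.
move=> mG _; apply: (measurability _ (RGenInftyO.measurableE R)) => //.
move=> _ [_ [a ->] <-]; rewrite setTI.
have -> : (fun x => G x v) @^-1` `]-oo, a[%classic = G @^-1` [set phi | phi v < a].
  by apply/seteqP; split => y /=; rewrite in_itv.
exact/mG/dual_open_eval_lt.
Qed.

End dual.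

(** The index sets given by basic weak neighbourhoods of [u] and tails generate a filter, proper by
    the definition of a cluster point; an ultrafilter above it acts as a subsequence converging
    weakly to [u]. *)
Lemma weak_cluster_ultra {R : realType} {U : completeNormedModType R}
    (ip : U -> U -> R) (Hip : is_inner_product ip) (x : nat -> U) (u : U) :
  weak_cluster ip x u ->
  exists G : set_system nat, [/\ UltraFilter G, \oo `<=` G & weak_cvg ip G x u].
Proof.
move=> wc.
pose V k h e N0 : set nat :=
  [set N | (N0 <= N)%N /\ forall i, (i < k)%N -> `|ip (x N - u) (h i)| < e].
pose F : set_system nat := [set A | exists k (h : nat -> U) (e : R) N0,
  0 < e /\ V k h e N0 `<=` A].
have PF : ProperFilter F.
  apply: Build_ProperFilter_ex.
    move=> A [k [h [e [N0 [e0 sub]]]]].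
    by have [N HN] := wc k h e N0 e0; exists N; apply: sub.
  split.
  - by exists 0%N, (fun=> 0), 1, 0%N.
  - move=> A A' [k [h [e [N0 [e0 sub]]]]] [k' [h' [e' [N0' [e0' sub']]]]].
    (* Two neighbourhoods are intersected by concatenating their lists of test vectors. *)
    exists (k + k')%N, (fun i => if (i < k)%N then h i else h' (i - k)%N),
      (Num.min e e'), (maxn N0 N0').
    split; first by rewrite lt_min e0.
    move=> N [NN HN]; rewrite geq_max in NN; case/andP: NN => N1 N2.
    split; [apply: sub|apply: sub']; split => // i ik.
      have := HN i _; rewrite ik lt_min (ltn_addr _ ik) => /(_ isT)/andP[]//.
    have := HN (k + i)%N _; rewrite ltn_add2l => /(_ ik).
    by rewrite [(k + i < k)%N]ltnNge leq_addr/= addKn lt_min => /andP[].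
  - move=> A A' AA' [k [h [e [N0 [e0 sub]]]]].
    by exists k, h, e, N0; split => //; exact: subset_trans AA'.
have [G [UG sG]] := ultraFilterLemma PF.
exists G; split => //.
  move=> A [N0 _ sub]; apply: sG; exists 0%N, (fun=> 0), 1, N0; split => // N [NN _].
  exact: sub.
move=> h; apply/cvgrPdist_lt => e e0; apply: sG.
exists 1%N, (fun=> h), e, 0%N; split => // N [_ /(_ 0%N isT)].
by rewrite distrC (ipDl Hip) (ipNl Hip).
Qed.

(** A weak limit along an ultrafilter finer than [\oo] is a cluster point, because the members of
    the ultrafilter meet every tail. *)
Lemma bounded_weak_cluster {R : realType} {U : completeNormedModType R}
    (ip : U -> U -> R) (Hip : is_inner_product ip) (x : nat -> U) (M : R) :
  (forall N, `|x N| <= M) -> exists u, weak_cluster ip x u.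
Proof.
move=> xM; have [G [UG sG]] := ultraFilterLemma (@eventually_filter).
have GM : \forall N \near G, `|x N| <= M by apply: sG; exists 0%N.
have [u xu] := bounded_weak_cvg Hip UG GM.
exists u => k h e N0 e0.
apply: (@filter_ex _ G); apply: filterI; first by apply: sG; exists N0.
have : \forall N \near G, forall i : 'I_k, `|ip (x N - u) (h i)| < e.
  apply: filter_forall => i.
  have /cvgrPdist_lt/(_ _ e0) := xu (h i); apply: filterS => N.
  by rewrite distrC (ipDl Hip) (ipNl Hip).
by apply: filterS => N HN i ik; exact: (HN (Ordinal ik)).
Qed.

(** * Gap functionals: a priori bound, uniform convergence and passage to the limit *)

Section gap_convergence.
Context {R : realType} {d d' : measure_display}.
Variables (U : completeNormedModType R) (ip : U -> U -> R).
Hypothesis Hip : is_inner_product ip.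
Variables (W : completeNormedModType R) (B : U -> W).
Hypothesis HB : compact_operator B.
Variable Bstar : (W -> R) -> U.
Hypothesis HBstar : forall phi : W -> R, dual_elem phi ->
  forall u : U, ip (Bstar phi) u = phi (B u).
Variable psi : U -> \bar R.
Hypothesis psi_ge0 : forall u, (0 <= psi u)%E.
Hypothesis psi_closed : closed_efun psi.
Hypothesis psi_convex : convex_efun psi.

Local Notation p u := (fine (psi u)).

Lemma edom_fineK u : edom psi u -> psi u = (p u)%:E.
Proof. by move=> Du; rewrite fineK// ge0_fin_numE. Qed.

Lemma sublevel_edom t u : (psi u <= t%:E)%E -> edom psi u.
Proof. by move/le_lt_trans; apply; rewrite ltry. Qed.

Lemma sublevel_convex t : convex_subset [set u | (psi u <= t%:E)%E].
Proof.
move=> u v l /= ut vt l01; apply: (le_trans (psi_convex _ _ l01)).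
have Du := edom_fineK (sublevel_edom ut); have Dv := edom_fineK (sublevel_edom vt).
rewrite Du Dv -!EFinM -EFinD lee_fin.
move: ut vt; rewrite Du Dv !lee_fin => ut vt; case/andP: l01 => l0 l1.
have := ler_wpM2l l0 ut; have l2 : 0 <= 1 - l by lra.
have := ler_wpM2l l2 vt; lra.
Qed.

(** Replaces an extended real supremum by real inequalities, and the adjoint by evaluation at
    [B (u - v)]; from here on functionals are only tested in such directions. *)
Lemma gap_leP (G : W -> W -> R) u c : dual_elem (G (B u)) -> edom psi u ->
  (gap ip B Bstar psi G u <= c%:E)%E <->
  (forall v, edom psi v -> G (B u) (B (u - v)) + p u - p v <= c).
Proof.
move=> dG Du; split => [H v Dv|H].
  rewrite -lee_fin; apply: le_trans H; apply: ereal_sup_ubound.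
  by exists v => //; rewrite HBstar// {1}(edom_fineK Du) {1}(edom_fineK Dv).
apply/ereal_supP => _ [v Dv <-].
rewrite HBstar// (edom_fineK Du) (edom_fineK Dv).
by have := H v Dv; rewrite -lee_fin.
Qed.

Lemma gap_ge0 (G : W -> W -> R) u : dual_elem (G (B u)) -> edom psi u ->
  (0 <= gap ip B Bstar psi G u)%E.
Proof.
move=> dG Du; apply: ereal_sup_ubound; exists u => //.
rewrite HBstar// subrr (compact_operator0 HB) (dual_elem0 dG) (edom_fineK Du).
by rewrite add0e -EFinB subrr.
Qed.

Variables (X : measurableType d') (Omega : measurableType d) (P : probability Omega R).
Variables (xi : Omega -> X) (xis : nat -> Omega -> X).
Hypothesis xi_meas : measurable_fun setT xi.
Hypothesis xis_meas : forall i, measurable_fun setT (xis i).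
Hypothesis xis_indep : indep_seq P xis.
Hypothesis xis_law : forall i, same_law P (xis i) xi.
Variable Dwf : W -> X -> (W -> R).
Hypothesis Dwf_dual : forall w x, (B @` edom psi) w -> dual_elem (Dwf w x).
Hypothesis Dwf_cont : forall x w0, (B @` edom psi) w0 ->
  forall e : R, 0 < e -> exists2 del : R, 0 < del &
    forall w, (B @` edom psi) w -> `|w - w0| < del ->
      dnorm (dsub (Dwf w x) (Dwf w0 x)) < e.
Hypothesis Dwf_meas : forall w, (B @` edom psi) w ->
  forall S : set (W -> R), dual_open S -> measurable ((fun x => Dwf w x) @^-1` S).
Variable zetaD : X -> R.
Hypothesis zetaD_ge0 : forall x, 0 <= zetaD x.
Hypothesis zetaD_meas : measurable_fun setT zetaD.
Hypothesis zetaD_int : P.-integrable setT (fun om => (zetaD (xi om))%:E).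
Hypothesis Dwf_bdd : forall x u, edom psi u ->
  forall v : W, `|Dwf (B u) x v| <= zetaD x * `|v|.

Local Notation Ez := (Rintegral P setT (fun om => zetaD (xi om))).

Lemma Dwf_eval_meas u v : edom psi u -> measurable_fun setT (fun x => Dwf (B u) x v).
Proof. by move=> Du; apply: measurable_dual_eval; apply: Dwf_meas; exists u. Qed.

Lemma Dwf_eval_int u v : edom psi u ->
  P.-integrable setT (fun om => (Dwf (B u) (xi om) v)%:E).
Proof.
move=> Du; apply: (@integrable_le _ _ _ _ _ (fun om => `|v| * zetaD (xi om))).
- by apply: (measurableT_comp (Dwf_eval_meas v Du)).
- by move=> om; rewrite mulrC Dwf_bdd.
- by under eq_fun do rewrite EFinM; exact: integrableZl.
Qed.

Lemma DhatF_bound u om N v : edom psi u ->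
  `|DhatF N xis Dwf om (B u) v| <= avg xis zetaD N om * `|v|.
Proof.
move=> Du; rewrite /DhatF /avg normrM normfV normr_nat -mulrA.
rewrite ler_wpM2l ?invr_ge0//.
apply: (le_trans (ler_norm_sum _ _ _)); rewrite mulr_suml.
by apply: ler_sum => i _; exact: Dwf_bdd.
Qed.

Lemma DhatF_dual u om N : edom psi u -> dual_elem (DhatF N xis Dwf om (B u)).
Proof.
move=> Du; have dD x := Dwf_dual x (ex_intro2 _ _ u Du erefl).
apply: (@dual_elem_of_bound _ _ _ (avg xis zetaD N om)) => [a v v'|v];
  last exact: DhatF_bound.
rewrite /DhatF mulrCA -mulrDr; congr (_ * _).
by rewrite mulr_sumr -big_split/=; apply: eq_bigr => i _; rewrite (dual_elemP (dD _)).
Qed.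

Lemma DF_dual u : edom psi u -> dual_elem (DF P xi Dwf (B u)).
Proof.
move=> Du; have dD x := Dwf_dual x (ex_intro2 _ _ u Du erefl).
have int v := Dwf_eval_int v Du.
apply: (@dual_elem_of_bound _ _ _ Ez) => [a v v'|v].
  rewrite /DF -(RintegralZl a measurableT (int v)).
  have inta : P.-integrable setT (EFin \o (fun om => a * Dwf (B u) (xi om) v)).
    by rewrite /comp; under eq_fun do rewrite EFinM; exact: integrableZl.
  rewrite -(RintegralD measurableT inta (int v')).
  by apply: eq_Rintegral => om _; rewrite (dual_elemP (dD _)).
rewrite /DF (le_trans (le_normr_Rintegral measurableT (int v)))//.
rewrite -(RintegralZr _ measurableT zetaD_int).
apply: le_Rintegral => //.
- exact: (integrable_norm (int v)).
- by rewrite /comp; under eq_fun do rewrite EFinM; exact: integrableZr.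
- by move=> om _; exact: Dwf_bdd.
Qed.

Variable M0 : R.
Hypothesis psi_dom_bdd : forall u, edom psi u -> `|u| <= M0.

(** Testing the gap with [v0] gives [psi (y N) <= p v0 + eps N + avg * L], where [avg] is the
    empirical mean of [zetaD]; eventually [eps N <= 1] and [avg <= Ez + 1]. *)
Lemma psi_approx_bounded v0 (L : R) om (eps : nat -> R) (y : nat -> U) :
  edom psi v0 -> (forall u v, edom psi u -> edom psi v -> `|B (u - v)| <= L) ->
  avg xis zetaD N om @[N --> \oo] --> Ez -> eps @ \oo --> 0 ->
  (forall N, edom psi (y N)) ->
  (forall N, (0 < N)%N ->
    (gap ip B Bstar psi (DhatF N xis Dwf om) (y N) <= (eps N)%:E)%E) ->
  \forall N \near \oo, (psi (y N) <= (p v0 + 1 + (Ez + 1) * L)%:E)%E.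
Proof.
move=> Dv0 BL avgE eps0 Dy gapy.
near=> N.
have N0 : (0 < N)%N by near: N; exact: nbhs_infty_gt.
have epsN : `|0 - eps N| < 1 by near: N; move/cvgrPdist_lt: eps0; apply.
have avgN : `|Ez - avg xis zetaD N om| < 1 by near: N; move/cvgrPdist_lt: avgE; apply.
have /(gap_leP _ (DhatF_dual om N (Dy N)) (Dy N))/(_ v0 Dv0) := gapy N N0.
have := DhatF_bound om N (B (y N - v0)) (Dy N).
have avg0 : 0 <= avg xis zetaD N om by rewrite mulr_ge0 ?invr_ge0// sumr_ge0.
have := ler_wpM2l avg0 (BL _ _ (Dy N) Dv0).
have L0 : 0 <= L by exact: le_trans (BL _ _ (Dy N) Dv0).
have avg1 : avg xis zetaD N om <= Ez + 1 by move: avgN; rewrite ltr_norml => /andP[]; lra.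
have := ler_wpM2r L0 avg1.
move: epsN; rewrite sub0r normrN ltr_norml => /andP[_ eps1].
rewrite (edom_fineK (Dy N)) lee_fin ler_norml => h1 h2 /andP[h3 _] h4.
lra.
Unshelve. all: by end_near. Qed.

Variable t : R.

Local Notation Lt := [set u | (psi u <= t%:E)%E].
(** Compact set of test directions; the radius [2 * M0] bounds the difference of two points of the
    domain. *)
Local Notation C1 := (closure (B @` [set z | `|z| <= 2 * M0])).
Local Notation KK := ((B @` Lt) `*` C1).

Lemma edom_diff_C1 u v : edom psi u -> edom psi v -> C1 (B (u - v)).
Proof.
move=> /psi_dom_bdd Mu /psi_dom_bdd Mv; apply: subset_closure; exists (u - v) => //=.
by apply: (le_trans (ler_normB _ _)); lra.
Qed.

Lemma C1_compact : compact C1.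
Proof. by have [_ cB] := HB; apply: cB; exact: norm_le_bounded_subset. Qed.

Lemma KK_compact : compact KK.
Proof.
apply: compact_setX; last exact: C1_compact.
apply: (compact_operator_image Hip HB); [exact: psi_closed|exact: sublevel_convex|].
by exists M0 => u /= /sublevel_edom; exact: psi_dom_bdd.
Qed.

Lemma C1_bounded : exists2 CB : R, 0 <= CB & forall c, C1 c -> `|c| <= CB.
Proof.
have /compact_bounded [K [_ KP]] := C1_compact.
exists (`|K| + 1); first by rewrite addr_ge0.
move=> c; apply: KP; first by rewrite (le_lt_trans (ler_norm K))// ltrDl.
Qed.

Local Notation h := (fun (m : W * W) x => Dwf m.1 x m.2).

(** The increment splits into a change of functional, small in dual norm and tested on the bounded
    set [C1], and a change of direction, controlled by [zetaD x]. The [+ 1] in the denominators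
    keeps them positive. *)
Lemma Dwf_joint_cont x q : KK q -> forall e : R, 0 < e ->
  exists2 del : R, 0 < del &
    forall r, KK r -> ball q del r -> `|h r x - h q x| < e.
Proof.
move: q => [w0 c0] [/= [u0 u0t <-] C0] e e0.
have [CB CB0 CBP] := C1_bounded.
have CB1 : 0 < CB + 1 by lra.
have z1 : 0 < zetaD x + 1 by have := zetaD_ge0 x; lra.
have e1 : 0 < e / 2 / (CB + 1) by rewrite !divr_gt0.
have e2 : 0 < e / 2 / (zetaD x + 1) by rewrite !divr_gt0.
have Du0 := sublevel_edom u0t.
have DB u : edom psi u -> (B @` edom psi) (B u) by exists u.
have [del del0 delP] := Dwf_cont x (DB _ Du0) e1.
exists (Num.min del (e / 2 / (zetaD x + 1))); first by rewrite lt_min del0.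
move=> [_ c] [/= [u ut <-] Cc] [/= b1 b2].
have Du := sublevel_edom ut.
have {}b1 : `|B u - B u0| < del.
  by move: b1; rewrite -ball_normE/= distrC lt_min => /andP[].
have {}b2 : `|c - c0| < e / 2 / (zetaD x + 1).
  by move: b2; rewrite -ball_normE/= distrC lt_min => /andP[].
have d1 := Dwf_dual x (DB _ Du); have d0 := Dwf_dual x (DB _ Du0).
have -> : Dwf (B u) x c - Dwf (B u0) x c0 =
    dsub (Dwf (B u) x) (Dwf (B u0) x) c + Dwf (B u0) x (c - c0).
  by rewrite /dsub (dual_elemB d0); ring.
apply: (le_lt_trans (ler_normD _ _)).
have h1 := dnorm_ub (dual_elem_dsub d1 d0) c.
have h2 : dnorm (dsub (Dwf (B u) x) (Dwf (B u0) x)) * `|c| <= e / 2 / (CB + 1) * CB.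
  apply: (@le_trans _ _ (e / 2 / (CB + 1) * `|c|)).
    by rewrite ler_wpM2r// ltW// delP//; exact: DB.
  by rewrite ler_wpM2l ?CBP// ltW.
have h3 : e / 2 / (CB + 1) * CB <= e / 2.
  by rewrite mulrAC ler_pdivrMr// ler_wpM2l//; lra.
have h4 := Dwf_bdd x Du0 (c - c0).
have h5 : zetaD x * `|c - c0| < e / 2.
  move: b2; rewrite ltr_pdivlMr// => b2; apply: le_lt_trans b2.
  by rewrite mulrC ler_wpM2l// lerDl.
lra.
Qed.

Lemma DhatF_uniform_cvg : {ae P, forall om, forall e : R, 0 < e ->
  \forall N \near \oo, forall w c, (B @` Lt) w -> C1 c ->
    `|DhatF N xis Dwf om w c - DF P xi Dwf w c| <= e}.
Proof.
have [CB CB0 CBP] := C1_bounded.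
have ae : {ae P, forall om, forall e : R, 0 < e ->
    \forall n \near \oo, forall m, KK m ->
      `|avg xis (h m) n om - Rintegral P setT (fun om => h m (xi om))| <= e}.
  apply: (uniform_law xi_meas xis_meas xis_indep xis_law KK_compact
    (z := fun x => CB * zetaD x)).
  - by move=> [w c] [/= [u ut <-] Cc]; apply: Dwf_eval_meas; exact: sublevel_edom ut.
  - by move=> x q; exact: Dwf_joint_cont.
  - move=> [w c] x [/= [u ut <-] Cc].
    apply: (le_trans (Dwf_bdd _ (sublevel_edom ut) _)).
    by rewrite mulrC ler_wpM2r// CBP.
  - by under eq_fun do rewrite EFinM; exact: integrableZl.
apply: filterS ae => om H e e0; apply: filterS (H e e0) => N HN w c Kw Cc.
(* By unfolding, [DhatF N xis Dwf om w c] is the average of [h (w, c)], and [DF] is its mean. *)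
exact: (HN (w, c)).
Qed.

(** * Deterministic argument for one outcome in the almost sure event *)

Section trajectory.
Variable om : Omega.
Hypothesis unif : forall e : R, 0 < e ->
  \forall N \near \oo, forall w c, (B @` Lt) w -> C1 c ->
    `|DhatF N xis Dwf om w c - DF P xi Dwf w c| <= e.

(* A uniform limit of continuous functions is continuous. *)
Lemma DF_joint_cvg {G : set_system nat} {PG : ProperFilter G}
    (w c : nat -> W) w0 c0 :
  (\forall N \near G, (B @` Lt) (w N) /\ C1 (c N)) -> (B @` Lt) w0 -> C1 c0 ->
  w @ G --> w0 -> c @ G --> c0 ->
  DF P xi Dwf (w N) (c N) @[N --> G] --> DF P xi Dwf w0 c0.
Proof.
move=> GK Kw0 Cc0 ww0 cc0; apply/cvgrPdist_le => e e0.
have e3 : 0 < e / 3 by lra.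
(* A single sample size [n] is fixed, so only finitely many functions, each continuous on [KK], have
   to converge along [G]. *)
have [n _ /(_ _ (leqnn n)) un] := unif e3.
have step : \forall N \near G, forall i : 'I_n,
    `|h (w N, c N) (xis i om) - h (w0, c0) (xis i om)| <= e / 3.
  apply: filter_forall => i.
  have [del del0 delP] := Dwf_joint_cont (xis i om) (conj Kw0 Cc0 : KK (w0, c0)) e3.
  near=> N; apply/ltW/delP; first by near: N; exact: GK.
  split; rewrite /= -ball_normE /ball_/=; near: N.
    by move/cvgrPdist_lt: ww0; apply.
  by move/cvgrPdist_lt: cc0; apply.
near=> N.
have [Kw Cc] : (B @` Lt) (w N) /\ C1 (c N) by near: N.
have h1 := un _ _ Kw Cc; have h2 := un _ _ Kw0 Cc0.
have h3 : `|DhatF n xis Dwf om (w N) (c N) - DhatF n xis Dwf om w0 c0| <= e / 3.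
  have st : forall i : 'I_n, `|h (w N, c N) (xis i om) - h (w0, c0) (xis i om)| <= e / 3.
    by near: N.
  rewrite /DhatF -mulrBr -sumrB normrM normfV normr_nat.
  have : \sum_(i < n) `|h (w N, c N) (xis i om) - h (w0, c0) (xis i om)| <=
      n%:R * (e / 3).
    rewrite mulr_natl -[n in _ *+ n]card_ord -sumr_const.
    by apply: ler_sum => i _; exact: st.
  move/(le_trans (ler_norm_sum _ _ _)) => le.
  (* The sample size [n] may be [0]; the inverse is then [0] and both averages vanish. *)
  have [->|n0] := eqVneq n 0%N; first by rewrite invr0 mul0r ltW.
  by rewrite ler_pdivrMl ?ltr0n ?lt0n.
move: h1 h2 h3; rewrite !ler_norml => /andP[? ?] /andP[? ?] /andP[? ?].
by apply/andP; split; lra.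
Unshelve. all: by end_near. Qed.

Variables (eps : nat -> R) (y : nat -> U).
Hypothesis eps_cvg : eps @ \oo --> 0.
Hypothesis y_dom : forall N, edom psi (y N).
Hypothesis y_sub : \forall N \near \oo, Lt (y N).
Hypothesis y_approx : forall N, (0 < N)%N ->
  (gap ip B Bstar psi (DhatF N xis Dwf om) (y N) <= (eps N)%:E)%E.

Lemma gap_DF_le e : 0 < e ->
  \forall N \near \oo, (gap ip B Bstar psi (DF P xi Dwf) (y N) <= e%:E)%E.
Proof.
move=> e0; have e2 : 0 < e / 2 by lra.
near=> N.
have N0 : (0 < N)%N by near: N; exact: nbhs_infty_gt.
have yN : Lt (y N) by near: N.
have un : forall w c, (B @` Lt) w -> C1 c ->
    `|DhatF N xis Dwf om w c - DF P xi Dwf w c| <= e / 2 by near: N; exact: unif.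
have epsN : eps N < e / 2.
  have : `|0 - eps N| < e / 2 by near: N; move/cvgrPdist_lt: eps_cvg; apply.
  by rewrite sub0r normrN; exact/le_lt_trans/ler_norm.
apply/(gap_leP _ (DF_dual (y_dom N)) (y_dom N)) => v Dv.
have /(gap_leP _ (DhatF_dual om N (y_dom N)) (y_dom N))/(_ v Dv) := y_approx N0.
have := un (B (y N)) (B (y N - v)) (ex_intro2 _ _ (y N) yN erefl)
  (edom_diff_C1 (y_dom N) Dv).
by rewrite ler_norml => /andP[]; lra.
Unshelve. all: by end_near. Qed.

Lemma gap_DF_cvg : gap ip B Bstar psi (DF P xi Dwf) (y N) @[N --> \oo] --> 0%E.
Proof.
have ge0 N := gap_ge0 (DF_dual (y_dom N)) (y_dom N).
apply/fine_cvgP; split.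
  apply: filterS (gap_DF_le ltr01) => N le1.
  by rewrite ge0_fin_numE// (le_lt_trans le1)// ltry.
apply/cvgrPdist_le => e e0; apply: filterS (gap_DF_le e0) => N le /=.
have fin : gap ip B Bstar psi (DF P xi Dwf) (y N) \is a fin_num.
  by rewrite ge0_fin_numE// (le_lt_trans le)// ltry.
by rewrite sub0r normrN ger0_norm ?fine_ge0// -lee_fin fineK.
Qed.

(** For each [v] the gap bound reads [psi (y N) <= p v - DF (B (y N)) (B (y N - v)) + e / 2]. Its
    right side is eventually below a fixed real level, because [DF] converges along [G], and the
    sublevel set of [psi] at that level is weakly closed. *)
Lemma weak_cluster_gap0 u : weak_cluster ip y u ->
  edom psi u /\ gap ip B Bstar psi (DF P xi Dwf) u = 0%E.
Proof.
move=> /(weak_cluster_ultra Hip)[G [UG sG yu]].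
have wcl s : (\forall N \near G, (psi (y N) <= s%:E)%E) -> (psi u <= s%:E)%E.
  move=> Gs.
  exact: (closed_convex_weak_closed Hip (@psi_closed s) (@sublevel_convex s) Gs yu).
have ut : Lt u by apply: wcl; exact: sG y_sub.
have Du := sublevel_edom ut.
have GM : \forall N \near G, `|y N| <= M0.
  by apply: sG; exists 0%N => // N _; exact: psi_dom_bdd.
have ByBu := compact_operator_weak_strong Hip HB UG GM yu.
split => //; apply/eqP; rewrite eq_le gap_ge0 ?andbT//; last exact: DF_dual.
apply/lee_addgt0Pr => e e0; rewrite add0e.
apply/(gap_leP _ (DF_dual Du) Du) => v Dv.
have e2 : 0 < e / 2 by lra.
have cv : DF P xi Dwf (B (y N)) (B (y N - v)) @[N --> G] -->
    DF P xi Dwf (B u) (B (u - v)).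
  apply: DF_joint_cvg => //.
  - have : \forall N \near G, Lt (y N) by exact: sG y_sub.
    by apply: filterS => N yN; split; [exists (y N)|exact: edom_diff_C1].
  - exact: edom_diff_C1.
  - rewrite (compact_operatorB HB); under eq_fun do rewrite (compact_operatorB HB).
    by apply: cvgB => //; exact: cvg_cst.
suff : (psi u <= (p v - DF P xi Dwf (B u) (B (u - v)) + e)%:E)%E.
  by rewrite {1}(edom_fineK Du) lee_fin; lra.
apply: wcl; have g := sG _ (gap_DF_le e2).
near=> N.
have c1 : `|DF P xi Dwf (B u) (B (u - v)) - DF P xi Dwf (B (y N)) (B (y N - v))| <= e / 2.
  by near: N; move/cvgrPdist_le: cv; apply.
have : (gap ip B Bstar psi (DF P xi Dwf) (y N) <= (e / 2)%:E)%E by near: N; exact: g.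
move=> /(gap_leP _ (DF_dual (y_dom N)) (y_dom N))/(_ v Dv).
rewrite (edom_fineK (y_dom N)) lee_fin; move: c1; rewrite ler_norml => /andP[]; lra.
Unshelve. all: by end_near. Qed.

End trajectory.

End gap_convergence.

Theorem theorem3p6
  (R : realType)
  (* U : separable Hilbert space, inner product ip *)
  (U : completeNormedModType R) (ip : U -> U -> R)
  (Hip : is_inner_product ip) (Usep : separable_space U)
  (* W : separable Banach space *)
  (W : completeNormedModType R) (Wsep : separable_space W)
  (* B : U -> W compact linear, Bstar its adjoint W^* -> U *)
  (B : U -> W) (HB : compact_operator B)
  (Bstar : (W -> R) -> U)
  (HBstar : forall phi : W -> R, dual_elem phi ->
              forall u : U, ip (Bstar phi) u = phi (B u))
  (* psi : proper closed convex, values in [0, +oo], bounded domain *)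
  (psi : U -> \bar R)
  (psi_ge0 : forall u, (0 <= psi u)%E)
  (psi_proper : exists u, (psi u < +oo)%E)
  (psi_closed : closed_efun psi) (psi_convex : convex_efun psi)
  (psi_dom_bdd : bounded_subset (edom psi))
  (* U0 : open convex bounded, containing dom psi *)
  (U0 : set U) (U0_open : open U0) (U0_convex : convex_subset U0)
  (U0_bdd : bounded_subset U0) (dom_sub : edom psi `<=` U0)
  (* Xi : complete separable metric space with its Borel sigma-field *)
  (Xi : completePseudoMetricType R) (Xi_hd : hausdorff_space Xi)
  (Xi_sep : separable_space Xi)
  (* complete probability space and the random elements *)
  (dO : measure_display) (Omega : measurableType dO)
  (P : probability Omega R) (P_complete : complete_prob P)
  (xi : Omega -> Borel Xi) (xi_meas : measurable_fun setT xi)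
  (xis : nat -> Omega -> Borel Xi)
  (xis_meas : forall i, measurable_fun setT (xis i))
  (xis_indep : indep_seq P xis)
  (xis_law : forall i, same_law P (xis i) xi)
  (* the integrand f and its bound *)
  (f : W -> Borel Xi -> R) (zetaf : Borel Xi -> R)
  (f_cont : forall x, {within B @` edom psi, continuous (fun w => f w x)})
  (f_meas : forall w, (B @` U0) w -> measurable_fun setT (f w))
  (f_bdd : forall u x, U0 u -> `|f (B u) x| <= zetaf x)
  (zetaf_meas : measurable_fun setT zetaf)
  (zetaf_int : P.-integrable setT (fun om => (zetaf (xi om))%:E))
  (* g_xi(u) = f(B u, xi) is C^1 on U0 with gradient grad xi *)
  (grad : Borel Xi -> U -> U)
  (g_diff : forall x u, U0 u ->
     differentiable (fun y => f (B y) x) u /\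
     ('d (fun y => f (B y) x) u : U -> R) = (fun h => ip (grad x u) h))
  (g_C1 : forall x, {within U0, continuous (grad x)})
  (* Caratheodory map D_w f : B(dom psi) x Xi -> W^* *)
  (Dwf : W -> Borel Xi -> (W -> R))
  (Dwf_dual : forall w x, (B @` edom psi) w -> dual_elem (Dwf w x))
  (Dwf_cont : forall x w0, (B @` edom psi) w0 ->
     forall e : R, 0 < e -> exists2 del : R, 0 < del &
       forall w, (B @` edom psi) w -> `|w - w0| < del ->
         dnorm (dsub (Dwf w x) (Dwf w0 x)) < e)
  (Dwf_meas : forall w, (B @` edom psi) w ->
     forall S : set (W -> R), dual_open S ->
       measurable ((fun x => Dwf w x) @^-1` S))
  (grad_Dwf : forall x u, edom psi u -> grad x u = Bstar (Dwf (B u) x))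
  (* integrable bound zetaDf *)
  (zetaD : Borel Xi -> R) (zetaD_ge0 : forall x, 0 <= zetaD x)
  (zetaD_meas : measurable_fun setT zetaD)
  (zetaD_int : P.-integrable setT (fun om => (zetaD (xi om))%:E))
  (grad_bdd : forall x u, U0 u -> `|grad x u| <= zetaD x)
  (Dwf_bdd : forall x u, edom psi u ->
     forall v : W, `|Dwf (B u) x v| <= zetaD x * `|v|)
  (* tolerances and approximate stationary points *)
  (eps : nat -> R) (eps_ge0 : forall N, 0 <= eps N)
  (eps_cvg : eps @ \oo --> 0)
  (ubar : nat -> Omega -> U)
  (ubar_meas : forall N (O : set U), open O -> measurable (ubar N @^-1` O))
  (ubar_dom : forall N om, edom psi (ubar N om))
  (ubar_approx : forall N, (0 < N)%N ->
     {ae P, forall om,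
       (gap ip B Bstar psi (DhatF N xis Dwf om) (ubar N om) <= (eps N)%:E)%E})
  :
  (* (i) *)
  {ae P, forall om,
     gap ip B Bstar psi (DF P xi Dwf) (ubar N om) @[N --> \oo] --> 0%E}
  /\
  (* (ii) *)
  {ae P, forall om,
     (exists u, weak_cluster ip (fun N => ubar N om) u) /\
     (forall u, weak_cluster ip (fun N => ubar N om) u ->
        edom psi u /\ gap ip B Bstar psi (DF P xi Dwf) u = 0%E)}.
Proof.
have [M0 HM0] := psi_dom_bdd; have [v0 Dv0] := psi_proper.
have [K K0 BK] := compact_operator_bounded HB.
have BL u v : edom psi u -> edom psi v -> `|B (u - v)| <= K * (2 * M0).
  move=> /HM0 Mu /HM0 Mv; apply: (le_trans (BK _)); rewrite ler_wpM2l//.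
  by apply: (le_trans (ler_normB _ _)); lra.
(* Built from a fixed competitor and an expectation, so [t] is known before any null set is
   discarded. *)
set t := fine (psi v0) + 1 +
  (Rintegral P setT (fun om => zetaD (xi om)) + 1) * (K * (2 * M0)).
have good : {ae P, forall om, [/\
    forall e : R, 0 < e -> \forall N \near \oo, forall w c,
      (B @` [set u | (psi u <= t%:E)%E]) w ->
      closure (B @` [set z | `|z| <= 2 * M0]) c ->
      `|DhatF N xis Dwf om w c - DF P xi Dwf w c| <= e,
    (\forall N \near \oo, (psi (ubar N om) <= t%:E)%E) &
    forall N, (0 < N)%N ->
      (gap ip B Bstar psi (DhatF N xis Dwf om) (ubar N om) <= (eps N)%:E)%E]}.
  have H1 := DhatF_uniform_cvg Hip HB psi_ge0 psi_closed psi_convex xi_meas xis_meas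
    xis_indep xis_law Dwf_dual Dwf_cont Dwf_meas zetaD_ge0 zetaD_int Dwf_bdd HM0 t.
  have H2 := strong_law xi_meas xis_meas xis_indep xis_law zetaD_meas zetaD_int.
  have H3 : {ae P, forall om, forall N, (0 < N)%N ->
      (gap ip B Bstar psi (DhatF N xis Dwf om) (ubar N om) <= (eps N)%:E)%E}.
    apply: ae_foralln => N; have [->|N0] := posnP N; first exact: aeW.
    by apply: filterS (ubar_approx N N0).
  apply: filterS3 H1 H2 H3 => om h1 h2 h3; split => //.
  exact: (psi_approx_bounded HBstar psi_ge0 Dwf_dual zetaD_ge0 Dwf_bdd Dv0 BL h2
    eps_cvg (ubar_dom^~ om) h3).
split.
  apply: filterS good => om [h1 h2 h3].
  exact: (gap_DF_cvg HB HBstar psi_ge0 xi_meas Dwf_dual Dwf_meas zetaD_int Dwf_bdd HM0 h1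
    eps_cvg (ubar_dom^~ om) h2 h3).
apply: filterS good => om [h1 h2 h3]; split.
  by apply: (@bounded_weak_cluster _ _ _ Hip _ M0) => N; apply: HM0.
move=> u.
exact: (weak_cluster_gap0 Hip HB HBstar psi_ge0 psi_closed psi_convex xi_meas Dwf_dual
  Dwf_cont Dwf_meas zetaD_ge0 zetaD_int Dwf_bdd HM0 h1 eps_cvg
  (ubar_dom^~ om) h2 h3).
Qed.
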